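(* Consider the switched descriptor system $E_{\sigma(t)}\dot x=A_{\sigma(t)}x$, $\sigma(t)\in\{1,2\}$, with $E_i,A_i\in\mathbb{R}^{n\times n}$, $A_1,A_2$ nonsingular. For $i=1,2$ let $(X_i,Y_i)$ be a full rank decomposition of $E_i$ with $X_i,Y_i\in\mathbb{R}^{n\times r}$ (so $\mathrm{rank}\,E_1=\mathrm{rank}\,E_2=r$), and set $\tilde E_i=Y_i^TA_i^{-1}X_i\in\mathbb{R}^{r\times r}$. Assume that for every solution, $Y_j^Tx(t_*^+)=Y_i^Tx(t_*^-)$ whenever $\sigma$ switches from $i$ to $j$ at $t_*$. Suppose: (a) $(E_1,A_1)$ and $(E_2,A_2)$ are stable; (b) $(E_1,A_1)$ has index one and $(E_2,A_2)$ has index two; (c) there exist vectors $g,h\in\mathbb{R}^r$ with $\tilde E_2=\tilde E_1-gh^T$, where $(\tilde E_1,g)$ is controllable and $(\tilde E_1,h)$ is observable (i.e. $(h^T,\tilde E_1)$ is an observable pair); (d) $\tilde E_1\tilde E_2$ has no negative real eigenvalues and exactly one zero eigenvalue. Then the switched system is GUES.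
   Context: For $E,A\in\mathbb{R}^{n\times n}$ with $A$ nonsingular, $(E,A)$ denotes the descriptor system $E\dot x=Ax$. It is stable if every root $s$ of $\det(sE-A)=0$ has negative real part. Its index is the smallest integer $k^*\ge0$ with $\mathrm{Im}((A^{-1}E)^{k^*+1})=\mathrm{Im}((A^{-1}E)^{k^*})$, and its consistency space is $\mathcal{C}(E,A)=\mathrm{Im}((A^{-1}E)^{k^*})$. A full rank decomposition of $E$ is a pair $(X,Y)$ of matrices with full column rank such that $E=XY^T$. Switched descriptor system: the switching signal $\sigma$ is piecewise constant with finitely many discontinuities in every bounded interval; a solution $x(\cdot)$ is differentiable and satisfies $E_{\sigma(t)}\dot x(t)=A_{\sigma(t)}x(t)$ at every $t$ where $\sigma$ is continuous, with one-sided limits $x(t_*^\pm)$ at discontinuities of $\sigma$ (the equation is not required there). The system is GUES if there exist $\beta,\alpha>0$ such that every solution satisfies $\|x(t)\|\le\beta e^{-\alpha(t-t_0)}\|x(t_0)\|$ for all $t\ge t_0$. *)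

(* Defs.v *)
From HB Require Import structures.
From Stdlib Require Import Reals ClassicalEpsilon FunctionalExtensionality.
From mathcomp Require Import all_boot all_order all_algebra.
Set Implicit Arguments. Unset Strict Implicit. Unset Printing Implicit Defensive.

Definition R_eqb (x y : R) : bool := if Req_EM_T x y then true else false.
Lemma R_eqP : Equality.axiom R_eqb.
Proof. by move=> x y; rewrite /R_eqb; case: Req_EM_T => h; constructor. Qed.
HB.instance Definition _ := hasDecEq.Build R R_eqP.

Definition R_find (P : pred R) (_ : nat) : option R :=
  match excluded_middle_informative (exists x, P x) with
  | left h => Some (proj1_sig (constructive_indefinite_description _ h))
  | right _ => None
  end.
Lemma R_find_correct P n x : R_find P n = Some x -> P x.
Proof.
rewrite /R_find; case: excluded_middle_informative => // h [<-].
by case: constructive_indefinite_description.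
Qed.
Lemma R_find_complete (P : pred R) : (exists x, P x) -> exists n, R_find P n.
Proof. by move=> h; exists 0%N; rewrite /R_find; case: excluded_middle_informative. Qed.
Lemma R_find_ext (P Q : pred R) : P =1 Q -> R_find P =1 R_find Q.
Proof. by move=> /functional_extensionality ->. Qed.
HB.instance Definition _ := hasChoice.Build R R_find_correct R_find_complete R_find_ext.

Lemma R_addA : associative Rplus. Proof. by move=> *; rewrite Rplus_assoc. Qed.
Lemma R_addC : commutative Rplus. Proof. exact: Rplus_comm. Qed.
Lemma R_add0 : left_id R0 Rplus. Proof. exact: Rplus_0_l. Qed.
Lemma R_addN : left_inverse R0 Ropp Rplus. Proof. exact: Rplus_opp_l. Qed.
HB.instance Definition _ := GRing.isZmodule.Build R R_addA R_addC R_add0 R_addN.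

Lemma R_mulA : associative Rmult. Proof. by move=> *; rewrite Rmult_assoc. Qed.
Lemma R_mulC : commutative Rmult. Proof. exact: Rmult_comm. Qed.
Lemma R_mul1 : left_id R1 Rmult. Proof. exact: Rmult_1_l. Qed.
Lemma R_mulD : left_distributive Rmult (@GRing.add R). Proof. exact: Rmult_plus_distr_r. Qed.
Lemma R_one_neq0 : R1 != R0.
Proof. by apply/eqP; exact: R1_neq_R0. Qed.
HB.instance Definition _ :=
  GRing.Zmodule_isComNzRing.Build R R_mulA R_mulC R_mul1 R_mulD R_one_neq0.

Definition R_inv (x : R) : R := if x == 0%R then 0%R else Rinv x.
Lemma R_mulV (x : R) : x != 0%R -> (R_inv x * x)%R = 1%R.
Proof. by move=> h; rewrite /R_inv (negbTE h); apply: Rinv_l; apply/eqP. Qed.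
Lemma R_inv0 : R_inv 0%R = 0%R.
Proof. by rewrite /R_inv eqxx. Qed.
HB.instance Definition _ := GRing.ComNzRing_isField.Build R R_mulV R_inv0.

Local Open Scope ring_scope.

Definition mxpow (n : nat) (M : 'M[R]_n) (k : nat) : 'M[R]_n := iter k (mulmx M) 1%:M.

Definition colspace_eq (m n p : nat) (M : 'M[R]_(m, n)) (N : 'M[R]_(m, p)) : bool :=
  (M^T == N^T)%MS.

Definition desc_index (n : nat) (E A : 'M[R]_n) (k : nat) : Prop :=
  let P := invmx A *m E in
  colspace_eq (mxpow P k.+1) (mxpow P k) /\
  (forall j : nat, (j < k)%N -> ~~ colspace_eq (mxpow P j.+1) (mxpow P j)).

(* complex numbers as pairs (Re, Im); complex evaluation of a real polynomial *)
Definition Cmul (z w : R * R) : R * R :=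
  (z.1 * w.1 - z.2 * w.2, z.1 * w.2 + z.2 * w.1).
Definition Chorner (p : {poly R}) (z : R * R) : R * R :=
  foldr (fun c acc => let m := Cmul acc z in (m.1 + c, m.2)) (0, 0) (polyseq p).

Definition pencil_poly (n : nat) (E A : 'M[R]_n) : {poly R} :=
  \det ('X *: map_mx polyC E - map_mx polyC A).

Definition desc_stable (n : nat) (E A : 'M[R]_n) : Prop :=
  forall a b : R, Chorner (pencil_poly E A) (a, b) = (0, 0) -> Rlt a R0.

Definition full_rank_decomp (n r : nat) (E : 'M[R]_n) (X Y : 'M[R]_(n, r)) : Prop :=
  \rank X = r /\ \rank Y = r /\ E = X *m Y^T.

Definition Etilde (n r : nat) (A : 'M[R]_n) (X Y : 'M[R]_(n, r)) : 'M[R]_r :=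
  Y^T *m invmx A *m X.

Definition ctrb_mx (r : nat) (M : 'M[R]_r) (g : 'cV[R]_r) : 'M[R]_r :=
  \matrix_(i < r, j < r) (mxpow M j *m g) i 0.
Definition controllable (r : nat) (M : 'M[R]_r) (g : 'cV[R]_r) : Prop :=
  \rank (ctrb_mx M g) = r.
Definition obsv_mx (r : nat) (c : 'rV[R]_r) (M : 'M[R]_r) : 'M[R]_r :=
  \matrix_(i < r, j < r) (c *m mxpow M i) 0 j.
Definition observable (r : nat) (c : 'rV[R]_r) (M : 'M[R]_r) : Prop :=
  \rank (obsv_mx c M) = r.

Definition vnorm (n : nat) (v : 'cV[R]_n) : R := sqrt (\sum_(i < n) (v i 0) ^+ 2).

Definition sel (T : Type) (k : nat) (a b : T) : T := if k == 1%N then a else b.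

Definition locally_const (sigma : R -> nat) (t : R) : Prop :=
  exists d : R, Rlt R0 d /\ forall s : R, Rlt (Rabs (Rminus s t)) d -> sigma s = sigma t.

Definition piecewise_constant (sigma : R -> nat) : Prop :=
  forall a b : R, exists l : list R,
    forall t : R, Rle a t -> Rle t b -> ~ List.In t l -> locally_const sigma t.

Definition left_mode (sigma : R -> nat) (t : R) (i : nat) : Prop :=
  exists d : R, Rlt R0 d /\ forall s : R, Rlt (Rminus t d) s -> Rlt s t -> sigma s = i.
Definition right_mode (sigma : R -> nat) (t : R) (j : nat) : Prop :=
  exists d : R, Rlt R0 d /\ forall s : R, Rlt t s -> Rlt s (Rplus t d) -> sigma s = j.

Definition left_lim (n : nat) (x : R -> 'cV[R]_n) (t : R) (v : 'cV[R]_n) : Prop :=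
  forall eps : R, Rlt R0 eps -> exists d : R, Rlt R0 d /\
    forall s : R, Rlt (Rminus t d) s -> Rlt s t -> Rlt (vnorm (x s - v)) eps.
Definition right_lim (n : nat) (x : R -> 'cV[R]_n) (t : R) (v : 'cV[R]_n) : Prop :=
  forall eps : R, Rlt R0 eps -> exists d : R, Rlt R0 d /\
    forall s : R, Rlt t s -> Rlt s (Rplus t d) -> Rlt (vnorm (x s - v)) eps.

Definition has_deriv (n : nat) (x : R -> 'cV[R]_n) (t : R) (dx : 'cV[R]_n) : Prop :=
  forall i : 'I_n, derivable_pt_lim (fun s => x s i 0) t (dx i 0).

(* (sigma, x) is a solution on [t0, oo) of the switched system
   E_sigma x' = A_sigma x, sigma(t) in {1,2}, satisfying the jump rule
   Y_j^T x(t+) = Y_i^T x(t-) when sigma switches from i to j.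
   Convention: at a switching time t, x(t) = x(t+) (right-continuity). *)
Definition is_solution (n r : nat) (E1 A1 E2 A2 : 'M[R]_n) (Y1 Y2 : 'M[R]_(n, r))
    (t0 : R) (sigma : R -> nat) (x : R -> 'cV[R]_n) : Prop :=
  (forall t : R, sigma t = 1%N \/ sigma t = 2%N) /\
  piecewise_constant sigma /\
  right_lim x t0 (x t0) /\
  (forall t : R, Rlt t0 t -> locally_const sigma t ->
     exists dx : 'cV[R]_n, has_deriv x t dx /\
       sel (sigma t) E1 E2 *m dx = sel (sigma t) A1 A2 *m x t) /\
  (forall t : R, Rlt t0 t -> ~ locally_const sigma t ->
     exists (xm : 'cV[R]_n) (i j : nat),
       left_lim x t xm /\ right_lim x t (x t) /\
       left_mode sigma t i /\ right_mode sigma t j /\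
       (sel j Y1 Y2)^T *m x t = (sel i Y1 Y2)^T *m xm).

Definition GUES (n r : nat) (E1 A1 E2 A2 : 'M[R]_n) (Y1 Y2 : 'M[R]_(n, r)) : Prop :=
  exists beta alpha : R, Rlt R0 beta /\ Rlt R0 alpha /\
    forall (t0 : R) (sigma : R -> nat) (x : R -> 'cV[R]_n),
      is_solution E1 A1 E2 A2 Y1 Y2 t0 sigma x ->
      forall t : R, Rle t0 t ->
        Rle (vnorm (x t)) (Rmult (Rmult beta (exp (Ropp (Rmult alpha (Rminus t t0))))) (vnorm (x t0))).

(* Main.v *)
Require Import Defs.
From HB Require Import structures.
From Stdlib Require Import Reals ClassicalEpsilon FunctionalExtensionality.
From Stdlib Require Lra.
From mathcomp Require Import all_boot all_order all_algebra.
From mathcomp Require Import ring lra.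
From mathcomp Require Import polyrcf complex polyXY.
Set Implicit Arguments. Unset Strict Implicit. Unset Printing Implicit Defensive.
Import Order.TTheory GRing.Theory Num.Theory.
Local Open Scope ring_scope.

(** In the variable [z = Y_i^T x], which is continuous across switches, mode [i]
    reads [T_i z' = z] with [T_i = Y_i^T A_i^-1 X_i].  Hence a matrix [P > 0] with
    [2 v^T P T_i v <= - k |T_i v|^2] for both modes makes [z^T P z] decay
    exponentially along every solution; the index conditions give back
    [x = G_i z], so that [x] decays as well.

    To find [P], write [T_2 = T_1 - g h^T], [a = det (s - T_1)],
    [c = det (s - T_2)], and let [w] be a flat output of [z' = T_1 z + g u], so
    that [a(D) w = u] and [c(D) w = u + h^T z]; the modes [z' = T_i z] are
    [a(D) w = 0] and [c(D) w = 0].  By the matrix determinant lemma,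
    [a(s) c(-s) + a(-s) c(s) = 2 f(-s^2)] with [f(y) = det (y + T_1 T_2)], and
    condition (d) says [f(y) = y q(y)] with [q > 0] on [[0, oo)].  Such a [q]
    stays nonnegative after subtracting a small multiple of
    [1 + y + ... + y^(r-1)], and a polynomial nonnegative on the half line is
    [e(s) e(-s)] at [y = - s^2]; so [2 f(-s^2)] is a sum of [d(s) d(-s)], where
    the [d] include positive multiples of [s, ..., s^r].  Therefore
    [c(s) a(t) + a(s) c(t) - \sum d(s) d(t)] is divisible by [s + t]; the
    quotient is the matrix of a quadratic form whose derivative is
    [2 (a(D) w) (c(D) w) - \sum (d(D) w)^2].  Its positivity follows from the
    stability of mode 1 by the inertia argument for Lyapunov equations. *)

(** * The real closed field of Stdlib reals *)

Definition R_leb (x y : R) : bool := if Rle_dec x y then true else false.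
Definition R_ltb (x y : R) : bool := (y != x) && R_leb x y.

Lemma R_lebP x y : reflect (Rle x y) (R_leb x y).
Proof. by rewrite /R_leb; case: Rle_dec => ?; constructor. Qed.

Lemma R_leb0D x y : R_leb 0 x -> R_leb 0 y -> R_leb 0 (x + y).
Proof. by move=> /R_lebP ? /R_lebP ?; apply/R_lebP/Rplus_le_le_0_compat. Qed.

Lemma R_leb0M x y : R_leb 0 x -> R_leb 0 y -> R_leb 0 (x * y).
Proof. by move=> /R_lebP ? /R_lebP ?; apply/R_lebP/Rmult_le_pos. Qed.

Lemma R_leb0_anti x : R_leb 0 x -> R_leb x 0 -> x = 0.
Proof. by move=> /R_lebP ? /R_lebP ?; apply: Rle_antisym. Qed.

Lemma R_leb_subr x y : R_leb 0 (y - x) = R_leb x y.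
Proof.
apply/R_lebP/R_lebP => [?|?]; first exact/Rge_le/Rminus_ge/Rle_ge.
exact/Rge_le/Rge_minus/Rle_ge.
Qed.

Lemma R_leb0_total x : R_leb 0 x || R_leb x 0.
Proof.
by case: (Rle_or_lt 0 x) => [|/Rlt_le] /R_lebP ->; rewrite ?orbT.
Qed.

Lemma R_leb0_norm x : R_leb 0 x -> Rabs x = x.
Proof. by move=> /R_lebP /Rabs_pos_eq. Qed.

HB.instance Definition _ := Num.IntegralDomain_isLeReal.Build R
  R_leb0D R_leb0M R_leb0_anti R_leb_subr R_leb0_total Rabs_Ropp R_leb0_norm
  (fun x y => erefl (R_ltb x y)).

Lemma RleP x y : reflect (Rle x y) (x <= y).
Proof. exact: R_lebP. Qed.

Lemma RltP x y : reflect (Rlt x y) (x < y).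
Proof.
rewrite lt_def; apply: (iffP andP) => [[/eqP nyx /RleP]|xy].
  by case=> // /esym.
by split; [apply/eqP/Rgt_not_eq | apply/RleP/Rlt_le].
Qed.

Lemma horner_continuity (p : {poly R}) : continuity (horner p).
Proof.
elim/poly_ind: p => [|p a IHp].
  rewrite (_ : horner 0 = fun=> 0); first by move=> x; exact: continuity_pt_const.
  by apply: functional_extensionality => y; rewrite horner0.
rewrite (_ : horner _ = plus_fct (mult_fct (horner p) id) (fun=> a)).
  apply: continuity_plus; last by move=> x; exact: continuity_pt_const.
  by apply: continuity_mult => //; exact/derivable_continuous/derivable_id.
by apply: functional_extensionality => y; rewrite hornerMXaddC.
Qed.

Lemma R_real_closed : Num.real_closed_axiom R.
Proof.
move=> p a b /RleP ab /andP[pa pb].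
have [|z [[/RleP az /RleP zb] pz]] := IVT_cor (horner p) a b (horner_continuity p) ab.
  by apply/RleP/mulr_le0_ge0.
by exists z; [rewrite az | apply/eqP].
Qed.
HB.instance Definition _ := Num.RealField_isClosed.Build R R_real_closed.

(** * Polynomials on the half line *)

Definition antipodal_mul {K : nzRingType} (p q : {poly K}) : {poly K} := p * (q \Po - 'X).

Definition scaled_powers {K : nzRingType} (eps : K) r : seq {poly K} :=
  [seq eps *: 'X^(k.+1) | k <- index_iota 0 r].

Section HalfLine.
Context {F : rcfType}.
Implicit Types (p q f m g e : {poly F}) (a b x : F).
Local Notation toC := (real_complex F).

Definition nonneg_on_half_line p := forall x, 0 <= x -> 0 <= p.[x].

Definition pos_on_half_line p := forall x, 0 <= x -> 0 < p.[x].

(* A negative value of the cofactor persists to the right, where [m] does not vanish. *)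
Lemma nonneg_cofactor m g : m != 0 -> nonneg_on_half_line m ->
  nonneg_on_half_line (m * g) -> nonneg_on_half_line g.
Proof.
move=> m_neq0 m_ge0 mg_ge0 x x_ge0; rewrite leNgt; apply/negP => gx_lt0.
have g_neq0 : g != 0 by apply: contraTneq gx_lt0 => ->; rewrite horner0 ltxx.
have x_lt1 : x < x + 1 by rewrite ltrDl.
have [y] := neighpr_wit x_lt1 (mulf_neq0 m_neq0 g_neq0).
rewrite neighpr_mul => /andP[/= y_m y_g].
have y_gt0 : 0 < y by apply: le_lt_trans x_ge0 _; rewrite (itvP y_m).
have gy_lt0 : g.[y] < 0.
  by rewrite -sgr_lt0 (sgr_neighprN _ y_g) ?sgr_lt0 // lt_eqF.
have my_gt0 : 0 < m.[y].
  by rewrite lt_def m_ge0 ?(ltW y_gt0) // andbT; exact: neighpr_root y_m.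
by have := mg_ge0 y (ltW y_gt0); rewrite hornerM leNgt pmulr_rlt0 ?gy_lt0.
Qed.

Lemma nonneg_interior_root f a : nonneg_on_half_line f -> 0 < a -> root f a ->
  ('X - a%:P) ^+ 2 %| f.
Proof.
move=> f_ge0 a_gt0 /factor_theorem[g fE]; rewrite fE.
suff /factor_theorem[h ->] : root g a by rewrite -mulrA -expr2 dvdp_mull.
have fx x : f.[x] = g.[x] * (x - a) by rewrite fE hornerM hornerXsubC.
apply/negPn/negP => ga_neq0.
have g_neq0 : g != 0 by apply: contraNneq ga_neq0 => ->; rewrite root0.
have [ga_gt0|ga_lt0|/esym/rootP] := ltgtP 0 g.[a]; last by rewrite (negbTE ga_neq0).
  have [y ya] := neighpl_wit a_gt0 g_neq0.
  have gy_gt0 : 0 < g.[y] by rewrite -sgr_gt0 (sgr_neighplN ga_neq0 ya) sgr_gt0.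
  have y_ge0 : 0 <= y.
    have := prev_root_in g 0 a; rewrite (min_l (ltW a_gt0)) => /itvP pr.
    by rewrite (le_trans _ (_ : prev_root g 0 a <= y)) ?pr // (itvP ya).
  by have := f_ge0 y y_ge0; rewrite fx pmulr_rge0 // subr_ge0 leNgt (itvP ya).
have a_lt1 : a < a + 1 by rewrite ltrDl.
have [y ya] := neighpr_wit a_lt1 g_neq0.
have gy_lt0 : g.[y] < 0 by rewrite -sgr_lt0 (sgr_neighprN ga_neq0 ya) sgr_lt0.
have a_lt_y : a < y by rewrite (itvP ya).
have := f_ge0 y (ltW (lt_trans a_gt0 a_lt_y)).
by rewrite fx nmulr_rge0 // subr_le0 leNgt a_lt_y.
Qed.

Definition quad_poly a b : {poly F} := ('X - a%:P) ^+ 2 + (b ^+ 2)%:P.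

Lemma size_quad_poly a b : size (quad_poly a b) = 3.
Proof.
rewrite size_polyDl ?size_exp_XsubC // (leq_ltn_trans (size_polyC_leq1 _)) //.
Qed.

Lemma quad_poly_ge0 a b : nonneg_on_half_line (quad_poly a b).
Proof.
by move=> x _; rewrite hornerD horner_exp hornerXsubC hornerC addr_ge0 ?sqr_ge0.
Qed.

Lemma complex_root_quad_dvdp f a b : b != 0 ->
  root (map_poly toC f) (Complex a b) -> quad_poly a b %| f.
Proof.
move=> b_neq0 rootf; rewrite -(dvdp_map toC).
have conj_neq : Complex a b != Complex a (- b).
  by rewrite eq_complex /= eqxx /= -subr_eq0 opprK -mulr2n mulrn_eq0.
have -> : map_poly toC (quad_poly a b) =
    \prod_(z <- [:: Complex a b; Complex a (- b)]) ('X - z%:P).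
  rewrite big_cons big_seq1 rmorphD /= rmorphXn /= rmorphB /= map_polyX !map_polyC /=.
  have -> : Complex a b = toC a + 'i%C * toC b by exact: complexE.
  have -> : Complex a (- b) = toC a - 'i%C * toC b.
    by rewrite [LHS]complexE /= rmorphN mulrN.
  have -> : toC (b ^+ 2) = - ('i%C * toC b) ^+ 2.
    by rewrite exprMn sqr_i mulN1r opprK rmorphXn.
  by rewrite !rmorphB !rmorphD /= rmorphN rmorphXn /=; ring.
apply: uniq_roots_dvdp; last by rewrite uniq_rootsE /= inE conj_neq.
rewrite /= rootf andbT /= -[Complex a (- b)]/((Complex a b)^*)%C.
rewrite -complex_root_conj -map_poly_comp.
by rewrite (eq_map_poly (g := toC)) // => x; exact: conjc_real.
Qed.

(* At [s = i w] the product [e(s) e(-s)] is [|e(i w)|^2], and [- s^2 = w^2 >= 0]. *)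
Definition spectral_factor f e :=
  f \Po (- 'X^2) = antipodal_mul e e /\ (size e <= size f)%N.

Lemma spectral_factorC x : 0 <= x -> spectral_factor x%:P (Num.sqrt x)%:P.
Proof.
move=> x_ge0; split; first by rewrite /antipodal_mul !comp_polyC -polyCM -expr2 sqr_sqrtr.
rewrite !size_polyC; have [->|_] := eqVneq x 0; first by rewrite sqrtr0 eqxx.
exact: leq_b1.
Qed.

Lemma spectral_factorM f1 e1 f2 e2 : f1 != 0 -> f2 != 0 ->
  spectral_factor f1 e1 -> spectral_factor f2 e2 ->
  spectral_factor (f1 * f2) (e1 * e2).
Proof.
move=> f1_neq0 f2_neq0 [f1E se1] [f2E se2].
split; first by rewrite /antipodal_mul !comp_polyM f1E f2E mulrACA.
rewrite (size_mul f1_neq0 f2_neq0) (leq_trans (size_polyMleq _ _)) //.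
by rewrite -!subn1 leq_sub2r // leq_add.
Qed.

Lemma spectral_factor_linear a : a <= 0 ->
  spectral_factor ('X - a%:P) ('X + (Num.sqrt (- a))%:P).
Proof.
move=> a_le0; split; last by rewrite size_XaddC size_XsubC.
rewrite /antipodal_mul comp_polyB comp_polyD !comp_polyX !comp_polyC.
have -> : a%:P = - (Num.sqrt (- a))%:P ^+ 2 :> {poly F}.
  by rewrite -rmorphXn /= sqr_sqrtr ?oppr_ge0 // polyCN opprK.
ring.
Qed.

Lemma spectral_factor_quad a b (rho := Num.sqrt (a ^+ 2 + b ^+ 2)) :
  spectral_factor (quad_poly a b)
    ('X^2 + (Num.sqrt (2 * (rho - a)))%:P * 'X + rho%:P).
Proof.
have norm_ge0 : 0 <= a ^+ 2 + b ^+ 2 by rewrite addr_ge0 ?sqr_ge0.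
have rhoK : rho ^+ 2 = a ^+ 2 + b ^+ 2 by rewrite sqr_sqrtr.
have a_le_rho : a <= rho.
  by rewrite (le_trans (ler_norm a)) // -sqrtr_sqr ler_sqrt // lerDl sqr_ge0.
set c := Num.sqrt (2 * (rho - a)).
have cK : c ^+ 2 = 2 * (rho - a) by rewrite sqr_sqrtr // mulr_ge0 // subr_ge0.
split; last first.
  rewrite size_quad_poly (leq_trans (size_polyD _ _)) // geq_max.
  rewrite (leq_trans (size_polyC_leq1 _)) // andbT.
  rewrite (leq_trans (size_polyD _ _)) // geq_max size_polyXn /=.
  by rewrite mul_polyC (leq_trans (size_scale_leq _ _)) // size_polyX.
rewrite /antipodal_mul /quad_poly !comp_polyD !rmorphXn /= comp_polyB comp_polyM.
rewrite !comp_polyX !comp_polyC.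
have -> : b%:P ^+ 2 = rho%:P ^+ 2 - a%:P ^+ 2 :> {poly F}.
  by rewrite -!polyC_exp -polyCB rhoK addrAC subrr add0r.
have cPK : c%:P ^+ 2 = 2 * (rho%:P - a%:P) :> {poly F}.
  by rewrite -polyC_exp cK polyCM polyCB polyC_natr.
transitivity (('X^2 + rho%:P) ^+ 2 - c%:P ^+ 2 * 'X^2); last by ring.
by rewrite cPK; ring.
Qed.

Theorem spectral_factorization f : nonneg_on_half_line f ->
  exists e, spectral_factor f e.
Proof.
have [n] := ubnP (size f); elim: n f => // n IHn f /ltnSE sf f_ge0.
have [f_const|f_nconst] := leqP (size f) 1.
  exists (Num.sqrt f`_0)%:P; rewrite [f](size1_polyC f_const) coefC; apply: spectral_factorC.
  by have := f_ge0 0 (lexx 0); rewrite horner_coef0.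
have split_off (d m : {poly F}) : (1 < size d)%N -> nonneg_on_half_line d -> d %| f ->
    spectral_factor d m -> exists e, spectral_factor f e.
  move=> sd d_ge0 /dvdpP[g fE] dm; rewrite mulrC in fE.
  have /norP[d_neq0 g_neq0] : ~~ ((d == 0) || (g == 0)).
    by rewrite -mulf_eq0 -fE -size_poly_gt0 ltnW.
  have g_ge0 : nonneg_on_half_line g.
    by apply: (nonneg_cofactor d_neq0 d_ge0); rewrite -fE.
  have sg : (size g < size f)%N.
    by rewrite fE size_mul // -(subnKC sd) addSn /= addSn ltnS leq_addl.
  have [e ge] := IHn g (leq_trans sg sf) g_ge0.
  by exists (m * e); rewrite fE; apply: spectral_factorM.
have /closed_rootP[[a b] rootf] : size (map_poly toC f) != 1.
  by rewrite size_map_poly neq_ltn f_nconst orbT.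
have [b0|b_neq0] := eqVneq b 0; last first.
  apply: (split_off (quad_poly a b)); last exact: spectral_factor_quad.
  - by rewrite size_quad_poly.
  - exact: quad_poly_ge0.
  - exact: complex_root_quad_dvdp.
have {rootf}fa : root f a.
  by move: rootf; rewrite b0 complexr0 fmorph_root.
have [a_le0|a_gt0] := leP a 0.
  apply: (split_off ('X - a%:P)); last exact: spectral_factor_linear.
  - by rewrite size_XsubC.
  - by move=> x x_ge0; rewrite hornerXsubC subr_ge0 (le_trans a_le0).
  - by rewrite -root_factor_theorem.
apply: (split_off (quad_poly a 0)); last exact: spectral_factor_quad.
- by rewrite size_quad_poly.
- exact: quad_poly_ge0.
- by rewrite /quad_poly expr0n addr0 nonneg_interior_root.
Qed.

End HalfLine.

Section Growth.

Lemma dist_half_line_ge (C : numClosedFieldType) (z : C) : ~~ (0 <= z) ->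
  exists2 d, 0 < d & forall x, 0 <= x -> d <= `|x - z|.
Proof.
move=> z_nge0; have [z_real|z_nreal] := boolP (z \is Num.real).
  have z_lt0 : z < 0 by rewrite real_ltNge ?real0.
  exists (- z) => [|x x_ge0]; first by rewrite oppr_gt0.
  by rewrite ger0_norm ?lerDr // subr_ge0 (le_trans (ltW z_lt0)).
exists `|'Im z| => [|x /ger0_real x_real].
  by rewrite normr_gt0; apply: contraNneq z_nreal => /Creal_ImP.
have ImE : 'Im (x - z) = - 'Im z.
  by rewrite raddfB /= (Creal_ImP _ x_real) sub0r.
rewrite -(@ler_pXn2r _ 2) ?nnegrE // (normC2_Re_Im (x - z)) ImE.
by rewrite sqrrN real_normK ?Creal_Im // lerDr real_exprn_even_ge0 ?Creal_Re.
Qed.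

Lemma dist_half_line_growth (C : numClosedFieldType) (z : C) : ~~ (0 <= z) ->
  exists2 d, 0 < d & forall x, 0 <= x -> d * (1 + x) <= `|x - z|.
Proof.
move=> /dist_half_line_ge[e e_gt0 dist_ge].
have s_gt0 : 0 < 1 + `|z| + e by rewrite addr_gt0 // ltr_pwDl.
exists (e / (1 + `|z| + e)) => [|x x_ge0]; first by rewrite divr_gt0.
rewrite mulrAC ler_pdivrMr // [leRHS]mulrDr.
apply: (@le_trans _ _ (e * (1 + `|z|) + e * `|x - z|)).
  rewrite -mulrDr ler_pM2l // -addrA lerD2l -[leLHS]ger0_norm //.
  by rewrite -[x in leLHS](subrK z) addrC ler_normD.
by rewrite [X in _ + X]mulrC lerD // ler_wpM2r ?dist_ge // addr_ge0.
Qed.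

Lemma dist_prod_growth (C : numClosedFieldType) (rs : seq C) :
  all (fun z => ~~ (0 <= z)) rs -> exists2 d, 0 < d &
  forall x, 0 <= x -> d * (1 + x) ^+ size rs <= `|\prod_(z <- rs) (x - z)|.
Proof.
elim: rs => [_|z rs IHrs /andP[/dist_half_line_growth[d d_gt0 d_le] /IHrs[e e_gt0 e_le]]].
  by exists 1 => // x _; rewrite big_nil normr1 mulr1.
exists (d * e) => [|x x_ge0]; first exact: mulr_gt0.
rewrite big_cons normrM exprS mulrACA.
by apply: ler_pM; rewrite ?d_le ?e_le // mulr_ge0 ?exprn_ge0 ?addr_ge0 // ltW.
Qed.

Context {F : rcfType}.
Implicit Types (p q : {poly F}) (x : F).
Local Notation toC := (real_complex F).

Lemma pos_poly_growth_ge q : pos_on_half_line q ->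
  exists2 d, 0 < d & forall x, 0 <= x -> d * (1 + x) ^+ (size q).-1 <= q.[x].
Proof.
move=> q_gt0; have [rs qE] := closed_field_poly_normal (map_poly toC q).
have q_neq0 : q != 0.
  by apply: contraTneq (q_gt0 0 (lexx 0)) => ->; rewrite horner0 ltxx.
set l := lead_coef _ in qE; have l_neq0 : l != 0.
  by rewrite lead_coef_eq0 map_poly_eq0.
have size_rs : size rs = (size q).-1.
  by rewrite -(size_map_poly toC) qE size_scale // size_prod_XsubC.
have [|d d_gt0 d_le] := @dist_prod_growth _ rs.
  apply/allP => z z_rs; apply: contraTN isT => z_ge0.
  have zE : z = toC (complex.Re z) by rewrite RRe_real ?ger0_real.
  have : root (map_poly toC q) z by rewrite qE rootZ // root_prod_XsubC.
  rewrite zE fmorph_root /root gt_eqF // q_gt0 //.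
  by rewrite -lecR -[X in _ <= X]zE.
have ld_gt0 : 0 < `|l| * d by rewrite mulr_gt0 // normr_gt0.
have ldE : `|l| * d = toC (complex.Re (`|l| * d)) by rewrite RRe_real ?gtr0_real.
exists (complex.Re (`|l| * d)) => [|x x_ge0]; first by rewrite -ltcR -[X in _ < X]ldE.
have qxE : toC q.[x] = `|l| * `|\prod_(z <- rs) (toC x - z)|.
  have -> : toC q.[x] = `|(map_poly toC q).[toC x]|.
    by rewrite horner_map ger0_norm //= ler0c ltW ?q_gt0.
  rewrite qE hornerZ horner_prod normrM; congr (_ * `|_|).
  by apply: eq_bigr => z _; rewrite hornerXsubC.
rewrite -lecR qxE rmorphM /= -ldE rmorphXn rmorphD rmorph1 /= -size_rs -mulrA.
by rewrite ler_pM2l ?normr_gt0 // d_le // ler0c.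
Qed.

Lemma poly_growth_le p n : (size p <= n.+1)%N ->
  exists2 d, 0 < d & forall x, 0 <= x -> p.[x] <= d * (1 + x) ^+ n.
Proof.
move=> sp; exists (1 + \sum_(k < n.+1) `|p`_k|) => [|x x_ge0].
  by rewrite ltr_pwDl // sumr_ge0.
have base_ge1 : 1 <= 1 + x by rewrite lerDl.
have pow_ge0 k : 0 <= (1 + x) ^+ k by rewrite exprn_ge0 // (le_trans ler01).
rewrite (horner_coef_wide _ sp) mulrDl mul1r mulr_suml ler_wpDl //.
apply: ler_sum => k _; apply: (@le_trans _ _ (`|p`_k| * x ^+ k)).
  by rewrite ler_wpM2r ?exprn_ge0 ?ler_norm.
rewrite ler_wpM2l // (@le_trans _ _ ((1 + x) ^+ k)) ?lerXn2r ?nnegrE ?lerDr //.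
  exact: le_trans ler01 base_ge1.
by rewrite ler_weXn2l // leq_ord.
Qed.

Lemma pos_poly_dominates p q : pos_on_half_line q -> (size p <= size q)%N ->
  exists2 eps, 0 < eps & nonneg_on_half_line (q - eps *: p).
Proof.
move=> q_gt0 spq; have [d d_gt0 d_le] := pos_poly_growth_ge q_gt0.
have [e e_gt0 le_e] := poly_growth_le (leq_trans spq (leqSpred _)).
exists (d / e) => [|x x_ge0]; first by rewrite divr_gt0.
rewrite hornerD hornerN hornerZ subr_ge0 (le_trans _ (d_le x x_ge0)) //.
by rewrite mulrAC ler_pdivrMr // mulrAC -mulrA ler_pM2l // le_e.
Qed.
End Growth.

Section SimpleZero.
Context {F : rcfType}.
Implicit Types (p q f d : {poly F}) (x eps : F).

Lemma noroot_half_line_gt0 q : 0 < lead_coef q ->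
  (forall x, 0 <= x -> ~~ root q x) -> pos_on_half_line q.
Proof.
move=> lq_gt0 q_nroot x x_ge0; rewrite -sgr_gt0.
rewrite (@sgp_pinftyP _ 0) ?sgr_gt0 // => [y|]; rewrite in_itv /= andbT //.
exact: q_nroot.
Qed.

Lemma simple_zero_cofactor f : 0 < lead_coef f ->
  (forall x, 0 < x -> ~~ root f x) -> mup 0 f = 1%N ->
  exists2 q, f = 'X * q & pos_on_half_line q.
Proof.
move=> lf_gt0 f_nroot f_mu; have f_neq0 : f != 0.
  by rewrite -lead_coef_eq0 gt_eqF.
have [m [q]] := multiplicity_XsubC f 0; rewrite f_neq0 /= => q0_nroot fE.
have m1 : m = 1%N by rewrite -f_mu fE mupMr // mup_XsubCX eqxx.
rewrite m1 subr0 mulrC in fE; exists q => //.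
apply: noroot_half_line_gt0 => [|x]; first by rewrite -(lead_coefMX q) mulrC -fE.
rewrite le_eqVlt => /predU1P[<- //|/f_nroot].
by rewrite fE rootM negb_or => /andP[].
Qed.

Lemma antipodal_scaled_powers r eps :
  \sum_(d <- scaled_powers eps r) antipodal_mul d d =
  - 'X^2 * ((eps ^+ 2 *: \sum_(k < r) 'X^k) \Po - 'X^2) :> {poly F}.
Proof.
rewrite big_map big_mkord comp_polyZ raddf_sum /= scaler_sumr mulr_sumr.
apply: eq_bigr => k _; rewrite /antipodal_mul comp_polyZ !rmorphXn /= !comp_polyX.
rewrite -scalerAl -!scalerAr scalerA -expr2 -exprMn -exprS.
by congr (_ *: _ ^+ _); ring.
Qed.

Lemma simple_zero_dissipation f r : size f = r.+1 -> 0 < lead_coef f ->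
  (forall x, 0 < x -> ~~ root f x) -> mup 0 f = 1%N ->
  exists eps d, [/\ 0 < eps, (size d <= r.+1)%N &
    2 *: (f \Po - 'X^2) =
    \sum_(p <- d :: scaled_powers eps r) antipodal_mul p p].
Proof.
move=> sf lf_gt0 f_nroot f_mu.
have [q fE q_gt0] := simple_zero_cofactor lf_gt0 f_nroot f_mu.
have q_neq0 : q != 0 by apply: contraTneq (q_gt0 0 (lexx 0)) => ->; rewrite horner0 ltxx.
have sq : size q = r by move: sf; rewrite fE mulrC size_mulX // => -[].
pose geom : {poly F} := \sum_(k < r) 'X^k.
have sgeom : (size geom <= size q)%N.
  rewrite sq (leq_trans (size_sum _ _ _)) //; apply/bigmax_leqP => k _.
  by rewrite size_polyXn.
have [eps eps_gt0 q_geom] := pos_poly_dominates q_gt0 sgeom.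
have [e [eE se]] := spectral_factorization q_geom.
exists (Num.sqrt (2 * eps)), (Num.sqrt 2 *: ('X * e)); split.
- by rewrite sqrtr_gt0 mulr_gt0.
- rewrite (leq_trans (size_scale_leq _ _)) // mulrC.
  have [->|e_neq0] := eqVneq e 0; first by rewrite mul0r size_poly0.
  rewrite size_mulX // ltnS (leq_trans se) // (leq_trans (size_polyD _ _)) //.
  by rewrite geq_max size_polyN -sq leqnn (leq_trans (size_scale_leq _ _)).
rewrite big_cons antipodal_scaled_powers sqr_sqrtr ?mulr_ge0 ?(ltW eps_gt0) //.
rewrite /antipodal_mul comp_polyZ comp_polyM comp_polyX -scalerAl -scalerAr scalerA -expr2.
rewrite sqr_sqrtr // -scalerA comp_polyZ fE comp_polyM comp_polyX.
have -> : q \Po - 'X^2 = antipodal_mul e e + ((eps *: geom) \Po - 'X^2).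
  by rewrite -eE comp_polyB subrK.
by rewrite /antipodal_mul -!mul_polyC; ring.
Qed.
End SimpleZero.

(** * Bilinear forms and Euclidean norms *)

Section BilinearForm.
Context {F : comNzRingType} {n : nat}.
Implicit Types (P S : 'M[F]_n) (x y z : 'cV[F]_n).

Definition bform P x y : F := (x^T *m P *m y) 0 0.

Lemma bform_addmx P S x y : bform (P + S) x y = bform P x y + bform S x y.
Proof. by rewrite /bform mulmxDr mulmxDl mxE. Qed.

Lemma bform_oppmx P x y : bform (- P) x y = - bform P x y.
Proof. by rewrite /bform mulmxN mulNmx mxE. Qed.

Lemma bform_scalemx a P x y : bform (a *: P) x y = a * bform P x y.
Proof. by rewrite /bform -scalemxAr -scalemxAl mxE. Qed.

Lemma bform_tr P x y : bform P^T x y = bform P y x.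
Proof.
rewrite /bform (_ : y^T *m P *m x = (x^T *m P^T *m y)^T) ?mxE //.
by rewrite !trmx_mul !trmxK mulmxA.
Qed.

Lemma bformC P x y : P^T = P -> bform P x y = bform P y x.
Proof. by move=> {1}<-; exact: bform_tr. Qed.

Lemma bformE P x y : bform P x y = \sum_i x i 0 * (P *m y) i 0.
Proof. by rewrite /bform -mulmxA mxE; apply: eq_bigr => i _; rewrite mxE. Qed.

Lemma bform_mulmxr P (A : 'M_n) x y : bform (P *m A) x y = bform P x (A *m y).
Proof. by rewrite /bform !mulmxA. Qed.

Lemma bform_mulmxl P (A : 'M_n) x y : bform (A^T *m P) x y = bform P (A *m x) y.
Proof. by rewrite /bform trmx_mul !mulmxA. Qed.

End BilinearForm.

Section Sqnorm.
Context {F : realFieldType}.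

Definition sqnorm n (v : 'cV[F]_n) : F := \sum_i v i 0 ^+ 2.

Lemma bform1 n (v : 'cV[F]_n) : bform 1%:M v v = sqnorm v.
Proof. by rewrite /bform mulmx1 mxE; apply: eq_bigr => i _; rewrite mxE. Qed.

Lemma sqnorm_ge0 n (v : 'cV[F]_n) : 0 <= sqnorm v.
Proof. by apply: sumr_ge0 => i _; rewrite sqr_ge0. Qed.

Lemma sqnorm0 n : sqnorm (0 : 'cV[F]_n) = 0.
Proof. by apply: big1 => i _; rewrite mxE expr0n. Qed.

Lemma sqnorm_gt0 n (v : 'cV[F]_n) : (0 < sqnorm v) = (v != 0).
Proof.
rewrite lt_def sqnorm_ge0 andbT; congr (~~ _).
rewrite psumr_eq0 => [|i _]; last exact: sqr_ge0.
apply/allP/eqP => [v0|-> i _]; last by rewrite /= mxE expr0n /= eqxx.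
apply/matrixP => i j; rewrite ord1 mxE; apply/eqP.
by have := v0 i (mem_index_enum i); rewrite /= sqrf_eq0.
Qed.

Lemma cauchy_schwarz_sum m (a b : 'I_m -> F) :
  (\sum_i a i * b i) ^+ 2 <= (\sum_i a i ^+ 2) * (\sum_i b i ^+ 2).
Proof.
have sumM (u v : 'I_m -> F) : (\sum_i u i) * (\sum_j v j) = \sum_i \sum_j u i * v j.
  by rewrite mulr_suml; apply: eq_bigr => i _; rewrite mulr_sumr.
have lagrange_ge0 : 0 <= \sum_i \sum_j (a i * b j - a j * b i) ^+ 2.
  by apply: sumr_ge0 => i _; apply: sumr_ge0 => j _; rewrite sqr_ge0.
have lagrangeE : \sum_i \sum_j (a i * b j - a j * b i) ^+ 2 =
    (\sum_i a i ^+ 2) * (\sum_i b i ^+ 2) + (\sum_i b i ^+ 2) * (\sum_i a i ^+ 2) -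
    2 * ((\sum_i a i * b i) * (\sum_i a i * b i)).
  rewrite !sumM mulr_sumr -big_split -sumrB; apply: eq_bigr => i _.
  by rewrite mulr_sumr -big_split -sumrB; apply: eq_bigr => j _ /=; ring.
by move: lagrange_ge0; rewrite lagrangeE; lra.
Qed.

Lemma sqnorm_mulmx m n (M : 'M[F]_(m, n)) :
  exists2 K, 0 < K & forall v : 'cV_n, sqnorm (M *m v) <= K * sqnorm v.
Proof.
have frob_ge0 : 0 <= \sum_i \sum_j M i j ^+ 2.
  by apply: sumr_ge0 => i _; apply: sumr_ge0 => j _; rewrite sqr_ge0.
exists (1 + \sum_i \sum_j M i j ^+ 2) => [|v]; first by rewrite ltr_pwDl.
rewrite mulrDl mul1r ler_wpDl ?sqnorm_ge0 // mulr_suml; apply: ler_sum => i _.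
by rewrite mxE; exact: cauchy_schwarz_sum.
Qed.

Lemma sqnorm_unitmx n (M : 'M[F]_n) : M \in unitmx ->
  exists2 K, 0 < K & forall v : 'cV_n, sqnorm v <= K * sqnorm (M *m v).
Proof.
move=> M_unit; have [K K_gt0 invM_le] := sqnorm_mulmx (invmx M).
by exists K => // v; rewrite -{1}[v](mulKmx M_unit).
Qed.

Lemma bform1_le n (x y : 'cV[F]_n) : 2 * `|bform 1%:M x y| <= sqnorm x + sqnorm y.
Proof.
rewrite /bform mulmx1 mxE -[2]normr_nat -normrM mulr_sumr /sqnorm -big_split.
rewrite (le_trans (ler_norm_sum _ _ _)) //; apply: ler_sum => i _; rewrite mxE /=.
rewrite ler_norml; have := sqr_ge0 (x i 0 + y i 0); have := sqr_ge0 (x i 0 - y i 0).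
by rewrite sqrrB sqrrD => sub_ge0 add_ge0; apply/andP; split; lra.
Qed.

Lemma bform_le n (P : 'M[F]_n) :
  exists2 K, 0 < K & forall z, bform P z z <= K * sqnorm z.
Proof.
have [K K_gt0 P_le] := sqnorm_mulmx P; exists (1 + K) => [|z]; first by rewrite addr_gt0.
rewrite -[P]mul1mx bform_mulmxr; have := bform1_le z (P *m z); have := P_le z.
have := ler_norm (bform 1%:M z (P *m z)); have := sqnorm_ge0 z.
have := mulr_ge0 (ltW K_gt0) (sqnorm_ge0 z); rewrite mulrDl mul1r; lra.
Qed.
End Sqnorm.
(** * Lyapunov inequalities *)

Section HermitianLyapunov.
Local Open Scope sesquilinear_scope.
Context {C : numClosedFieldType}.

Lemma trmxC_mul m n p (A : 'M[C]_(m, n)) (B : 'M_(n, p)) :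
  (A *m B)^t* = B^t* *m A^t*.
Proof. by rewrite trmx_mul map_mxM. Qed.

Lemma trmxC_block m1 m2 n1 n2 (Aul : 'M[C]_(m1, n1)) (Aur : 'M_(m1, n2))
    (Adl : 'M_(m2, n1)) (Adr : 'M_(m2, n2)) :
  (block_mx Aul Aur Adl Adr)^t* = block_mx (Aul^t* ) (Adl^t* ) (Aur^t* ) (Adr^t* ).
Proof. by rewrite tr_block_mx map_block_mx. Qed.

Definition hform n (P : 'M[C]_n) (v : 'cV_n) : C := (v^t* *m P *m v) 0 0.

Definition hposdef n (P : 'M[C]_n) := forall v : 'cV_n, v != 0 -> 0 < hform P v.

(* [hposdef (lyap_residual A P)] says that [v^* P v] decreases along [v' = A v]. *)
Definition lyap_residual n (A P : 'M[C]_n) : 'M[C]_n := - (A^t* *m P + P *m A).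

Lemma hform0 n (P : 'M[C]_n) : hform P 0 = 0.
Proof. by rewrite /hform mulmx0 mxE. Qed.

Lemma hposdef_unit n (P : 'M[C]_n) : hposdef P -> P \in unitmx.
Proof.
move=> P_pos; rewrite unitmxE unitfE; apply/negP => /det0P[v v_neq0 vP].
have vt_neq0 : v^t* != 0.
  by apply: contraNneq v_neq0 => vt0; rewrite -[v]trmxCK vt0 trmx0 map_mx0.
by have := P_pos _ vt_neq0; rewrite /hform trmxCK vP mul0mx mxE ltxx.
Qed.

Lemma hposdef_congr m n (L : 'M[C]_(m, n)) (P : 'M_m) : row_full L ->
  hposdef P -> hposdef (L^t* *m P *m L).
Proof.
move=> L_full P_pos v v_neq0.
have -> : hform (L^t* *m P *m L) v = hform P (L *m v).
  by rewrite /hform trmxC_mul !mulmxA.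
apply: P_pos; apply: contraNneq v_neq0 => Lv0; apply/eqP/(row_full_inj L_full).
by rewrite Lv0 mulmx0.
Qed.

Lemma lyap_residual_congr n (L A P : 'M[C]_n) : L \in unitmx ->
  L^t* *m lyap_residual A P *m L =
  lyap_residual (invmx L *m A *m L) (L^t* *m P *m L).
Proof.
move=> L_unit; rewrite /lyap_residual mulmxN mulNmx mulmxDr mulmxDl !trmxC_mul.
have LtK : (invmx L)^t* *m L^t* = 1%:M by rewrite -trmxC_mul mulmxV // trmx1 map_mx1.
congr (- (_ + _)); rewrite !mulmxA; last by rewrite mulmxK.
by rewrite -[_ *m (invmx L)^t* *m _]mulmxA LtK mulmx1.
Qed.

Lemma hform_block_diag m n (P1 : 'M[C]_m) (P2 : 'M_n) v1 v2 :
  hform (block_mx P1 0 0 P2) (col_mx v1 v2) = hform P1 v1 + hform P2 v2.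
Proof.
rewrite /hform tr_col_mx map_row_mx mul_row_block !mulmx0 addr0 add0r.
by rewrite mul_row_col mxE.
Qed.

Lemma hposdef_block_diag m n (P1 : 'M[C]_m) (P2 : 'M_n) :
  hposdef P1 -> hposdef P2 -> hposdef (block_mx P1 0 0 P2).
Proof.
move=> P1_pos P2_pos v; rewrite -[v]vsubmxK hform_block_diag.
move: (usubmx v) (dsubmx v) => v1 v2.
have [->|v1_neq0 _] := eqVneq v1 0.
  have [->|v2_neq0 _] := eqVneq v2 0; first by rewrite col_mx0 eqxx.
  by rewrite hform0 add0r P2_pos.
have [->|v2_neq0] := eqVneq v2 0; first by rewrite hform0 addr0 P1_pos.
by rewrite addr_gt0 ?P1_pos ?P2_pos.
Qed.

Lemma hposdef_ulsub m n (P : 'M[C]_(m + n)) : hposdef P -> hposdef (ulsubmx P).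
Proof.
move=> P_pos; have -> : ulsubmx P = (col_mx 1%:M 0)^t* *m P *m col_mx 1%:M 0.
  rewrite -{2}[P]submxK tr_col_mx map_row_mx trmx1 trmx0 map_mx1 map_mx0 mul_row_block.
  by rewrite !mul0mx !mul1mx !addr0 mul_row_col mulmx1 mulmx0 addr0.
apply: hposdef_congr => //; apply/row_fullP; exists (row_mx 1%:M 0).
by rewrite mul_row_col mulmx1 mul0mx addr0.
Qed.

Lemma hposdef_drsub m n (P : 'M[C]_(m + n)) : hposdef P -> hposdef (drsubmx P).
Proof.
move=> P_pos; have -> : drsubmx P = (col_mx 0 1%:M)^t* *m P *m col_mx 0 1%:M.
  rewrite -{2}[P]submxK tr_col_mx map_row_mx trmx1 trmx0 map_mx1 map_mx0 mul_row_block.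
  by rewrite !mul0mx !mul1mx !add0r mul_row_col mulmx1 mulmx0 add0r.
apply: hposdef_congr => //; apply/row_fullP; exists (row_mx 0 1%:M).
by rewrite mul_row_col mulmx1 mul0mx add0r.
Qed.

Definition schur_complement m n (P : 'M[C]_(m + n)) : 'M[C]_m :=
  ulsubmx P - ursubmx P *m invmx (drsubmx P) *m dlsubmx P.

Definition schur_transform m n (P : 'M[C]_(m + n)) : 'M[C]_(m + n) :=
  block_mx 1%:M 0 (invmx (drsubmx P) *m dlsubmx P) 1%:M.

Lemma schur_transform_unit m n (P : 'M[C]_(m + n)) : schur_transform P \in unitmx.
Proof. by rewrite unitmxE det_lblock !det1 mulr1 unitr1. Qed.

Lemma schur_diagonalization m n (P : 'M[C]_(m + n)) :
  P^t* = P -> drsubmx P \in unitmx ->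
  (schur_transform P)^t* *m block_mx (schur_complement P) 0 0 (drsubmx P) *m
    schur_transform P = P.
Proof.
move=> P_herm Pdr_unit; rewrite /schur_transform; set k := invmx _ *m dlsubmx P.
have Pdr_herm : (drsubmx P)^t* = drsubmx P by rewrite trmx_drsub map_drsubmx P_herm.
have Pdl_herm : (dlsubmx P)^t* = ursubmx P by rewrite trmx_dlsub map_ursubmx P_herm.
have kP : k^t* *m drsubmx P = ursubmx P.
  by rewrite -{1}Pdr_herm -trmxC_mul mulKVmx.
rewrite trmxC_block !trmx1 !map_mx1 trmx0 map_mx0.
rewrite !mulmx_block !mulmx0 !mul0mx !mul1mx !mulmx1 !addr0 !add0r kP.
by rewrite mulmxA mulKVmx // subrK submxK.
Qed.

Lemma drsub_lyap_residual m n (A P : 'M[C]_(m + n)) : ursubmx A = 0 ->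
  drsubmx (lyap_residual A P) = lyap_residual (drsubmx A) (drsubmx P).
Proof.
move=> Aur0; rewrite /lyap_residual -{1 2}[A]submxK -{1 2}[P]submxK Aur0.
rewrite trmxC_block trmx0 map_mx0 !mulmx_block add_block_mx opp_block_mx.
by rewrite block_mxKdr !mulmx0 !mul0mx !add0r.
Qed.

Lemma ulsub_lyap_residual_diag m n (A : 'M[C]_(m + n)) (P1 : 'M_m) (P2 : 'M_n) :
  ulsubmx (lyap_residual A (block_mx P1 0 0 P2)) = lyap_residual (ulsubmx A) P1.
Proof.
rewrite /lyap_residual -{1 2}[A]submxK trmxC_block !mulmx_block add_block_mx.
by rewrite opp_block_mx block_mxKul !mulmx0 !mul0mx !addr0.
Qed.

Lemma ulsub_schur_conj m n (A P : 'M[C]_(m + n)) : ursubmx A = 0 ->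
  ulsubmx (schur_transform P *m A *m invmx (schur_transform P)) = ulsubmx A.
Proof.
move=> Aur0; rewrite /schur_transform; set k := invmx (drsubmx P) *m _.
have -> : invmx (block_mx 1%:M 0 k 1%:M) = block_mx 1%:M 0 (- k) 1%:M.
  apply: (can_inj (mulKmx (schur_transform_unit P))).
  rewrite mulmxV ?schur_transform_unit // mulmx_block !mulmx0 !mul0mx !mul1mx.
  by rewrite !mulmx1 !addr0 !add0r subrr -scalar_mx_block.
rewrite -{1}[A]submxK Aur0 !mulmx_block !mulmx0 !mul0mx !mul1mx !mulmx1 !addr0.
by rewrite block_mxKul mul0mx addr0.
Qed.

Lemma hposdef_lyap11 (A P : 'M[C]_1) : A 0 0 + (A 0 0)^* < 0 ->
  hposdef (lyap_residual A P) -> hposdef P.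
Proof.
move=> A_neg res_pos v v_neq0; have := res_pos v v_neq0.
have -> : hform (lyap_residual A P) v = - (A 0 0 + (A 0 0)^* ) * hform P v.
  by rewrite /hform !(mxE, big_ord1); ring.
by rewrite pmulr_rgt0 ?oppr_gt0.
Qed.

(* The last vectors span an invariant subspace, and its [P]-orthogonal complement
   sees only the first diagonal entry of [A]. *)
Lemma hposdef_lyap_deflate n (A P : 'M[C]_(1 + n)) : ursubmx A = 0 -> P^t* = P ->
  A 0 0 + (A 0 0)^* < 0 -> hposdef (drsubmx P) ->
  hposdef (lyap_residual A P) -> hposdef P.
Proof.
move=> Aur0 P_herm A_neg Pdr_pos res_pos.
have diagE := schur_diagonalization P_herm (hposdef_unit Pdr_pos).
rewrite -diagE.
apply: hposdef_congr (hposdef_block_diag _ Pdr_pos).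
  by rewrite row_full_unit schur_transform_unit.
set L := schur_transform P in diagE.
have L_unit : L \in unitmx := schur_transform_unit P.
pose A' := L *m A *m invmx L.
have A'_neg : ulsubmx A' 0 0 + (ulsubmx A' 0 0)^* < 0.
  by rewrite ulsub_schur_conj // !mxE lshift0.
apply: (hposdef_lyap11 A'_neg).
rewrite -(ulsub_lyap_residual_diag A' _ (drsubmx P)); apply: hposdef_ulsub.
set D := block_mx _ 0 0 _ in diagE *.
have -> : lyap_residual A' D = (invmx L)^t* *m lyap_residual A P *m invmx L.
  rewrite lyap_residual_congr ?unitmx_inv // invmxK; congr lyap_residual.
  rewrite -diagE !mulmxA -trmxC_mul mulmxV // trmx1 map_mx1 mul1mx.
  by rewrite mulmxK.
by apply: hposdef_congr; rewrite ?row_full_unit ?unitmx_inv.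
Qed.

Lemma trig_hposdef_lyap n (A P : 'M[C]_n) : is_trig_mx A -> P^t* = P ->
  (forall i, A i i + (A i i)^* < 0) -> hposdef (lyap_residual A P) -> hposdef P.
Proof.
elim: n A P => [|n IHn] A P A_trig P_herm A_neg res_pos.
  by move=> v; rewrite (flatmx0 v) eqxx.
have Aur0 : @ursubmx _ 1 n 1 n A = 0.
  by apply/matrixP => i j; rewrite !mxE; apply: (is_trig_mxP A_trig); rewrite ord1.
apply: (@hposdef_lyap_deflate n A) => //; apply: (IHn (@drsubmx _ 1 n 1 n A)).
- apply/is_trig_mxP => i j ij; rewrite !mxE.
  by apply: (is_trig_mxP A_trig); rewrite /= ltn_add2l.
- by rewrite trmx_drsub map_drsubmx P_herm.
- by move=> i; rewrite !mxE.
by rewrite -drsub_lyap_residual //; apply: hposdef_drsub.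
Qed.

Theorem hurwitz_hposdef_lyap n (A P : 'M[C]_n) : P^t* = P ->
  (forall l, eigenvalue A l -> l + l^* < 0) ->
  hposdef (lyap_residual A P) -> hposdef P.
Proof.
case: n A P => [|n] A P P_herm A_hurwitz res_pos.
  by move=> v; rewrite (flatmx0 v) eqxx.
have [U U_unitary] := Schur A (ltn0Sn n); rewrite /similar_to /= => U_trig.
have U_unit := unitarymx_unit U_unitary; have conjE := conjumx A U_unit.
have Ui_unit : invmx U \in unitmx by rewrite unitmx_inv.
have UK : (invmx U)^t* = U by rewrite invmx_unitary // trmxCK.
have -> : P = U^t* *m ((invmx U)^t* *m P *m invmx U) *m U.
  by rewrite UK -invmx_unitary // !mulmxA mulVmx // mul1mx mulmxKV.
apply: hposdef_congr; first by rewrite row_full_unit.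
apply: (@trig_hposdef_lyap _ (conjmx U A)) => //.
- by rewrite !trmxC_mul trmxCK P_herm UK mulmxA.
- move=> i; apply: A_hurwitz.
  apply: (@eigenvalue_conjmx _ _ _ U); rewrite ?stablemx_unit ?row_free_unit //.
  rewrite -[_ \in _]/(eigenvalue _ _) eigenvalue_root_char char_poly_trig // (bigD1 i) //=.
  by rewrite rootM root_XsubC eqxx.
rewrite conjE -[U in U *m A]invmxK -lyap_residual_congr //.
by apply: hposdef_congr; rewrite ?row_full_unit.
Qed.
End HermitianLyapunov.

Section RealLyapunov.
Local Open Scope sesquilinear_scope.
Context {F : rcfType} {n : nat}.
Implicit Types (A P S : 'M[F]_n).
Local Notation toC := (map_mx (real_complex F)).

Definition hurwitz A := forall l, eigenvalue (toC A) l -> complex.Re l < 0.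

Definition posdef S := forall v : 'cV_n, v != 0 -> 0 < bform S v v.

Lemma trmxC_real m p (M : 'M[F]_(m, p)) : (toC M)^t* = toC M^T.
Proof. by apply/matrixP => i j; rewrite !mxE; exact: conjc_real. Qed.

Lemma hform_real S (x y : 'cV_n) : S^T = S ->
  hform (toC S) (toC x + 'i%C *: toC y) = (bform S x x + bform S y y)%:C%C.
Proof.
move=> S_sym.
have conjE : (toC x + 'i%C *: toC y)^t* = toC x^T - 'i%C *: toC y^T.
  rewrite -!trmxC_real linearD linearZ /= map_mxD map_mxZ /= -scaleNr.
  by congr (_ + _ *: _); rewrite complexiE; exact: conjCi.
have mxE_form : (toC x + 'i%C *: toC y)^t* *m toC S *m (toC x + 'i%C *: toC y) =
    toC (x^T *m S *m x + y^T *m S *m y) + 'i%C *: toC (x^T *m S *m y - y^T *m S *m x).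
  rewrite conjE !mulmxDl !mulmxDr -!scalemxAr !mulNmx -!scalemxAl !map_mxD !map_mxN.
  rewrite !map_mxM /= scalerDr !scalerN !scalerA -expr2 sqr_i scaleN1r opprK.
  by rewrite -!addrA; congr (_ + _); rewrite addrA addrC.
have cross0 : (x^T *m S *m y - y^T *m S *m x) 0 0 = 0.
  by rewrite mxE [X in _ + X]mxE -/(bform S x y) -/(bform S y x) bformC // subrr.
by rewrite /hform mxE_form mxE [X in _ + X]mxE ![toC _ _ _]mxE cross0 mulr0 addr0 mxE.
Qed.

Lemma posdef_complex S : S^T = S -> posdef S -> hposdef (toC S).
Proof.
move=> S_sym S_pos v v_neq0.
pose x := map_mx (@complex.Re F) v; pose y := map_mx (@complex.Im F) v.
have vE : v = toC x + 'i%C *: toC y.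
  by apply/matrixP => i j; rewrite !mxE; exact: complexE.
rewrite vE hform_real // ltcR.
have [x0|x_neq0] := eqVneq x 0; last first.
  apply: ltr_pwDl; first exact: S_pos.
  by have [->|/S_pos/ltW //] := eqVneq y 0; rewrite /bform mulmx0 mxE.
rewrite x0 {1}/bform mulmx0 mxE add0r; apply: S_pos.
by apply: contraNneq v_neq0 => y0; rewrite vE x0 y0 !map_mx0 scaler0 addr0.
Qed.

Lemma hurwitz_posdef_lyap A P : P^T = P -> hurwitz A ->
  (forall v : 'cV_n, v != 0 -> bform P v (A *m v) < 0) -> posdef P.
Proof.
move=> P_sym A_hurwitz decr; pose S := - (A^T *m P + P *m A).
have S_sym : S^T = S.
  by rewrite linearN linearD /= !trmx_mul trmxK P_sym addrC.
have S_pos : posdef S.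
  move=> v /decr; rewrite bform_oppmx bform_addmx bform_mulmxl bform_mulmxr.
  by rewrite (bformC (A *m v)) //; lra.
have SE : lyap_residual (toC A) (toC P) = toC S.
  by rewrite /lyap_residual trmxC_real -!map_mxM -map_mxD -map_mxN.
have P_hposdef : hposdef (toC P).
  apply: (@hurwitz_hposdef_lyap _ _ (toC A)).
  - by rewrite trmxC_real P_sym.
  - by move=> l /A_hurwitz; rewrite -ltcR addcJ pmulr_rlt0 ?ltr0n.
  by rewrite SE; apply: posdef_complex.
move=> v v_neq0; have := P_hposdef (toC v); rewrite map_mx_eq0 => /(_ v_neq0).
by rewrite /hform trmxC_real -!map_mxM mxE ltcR.
Qed.

Lemma hurwitz_lyap_coercive A P k : P^T = P -> hurwitz A -> 0 < k ->
  (forall v, 2 * bform P v (A *m v) <= - k * sqnorm v) ->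
  exists2 d, 0 < d & forall v, d * sqnorm v <= bform P v v.
Proof.
move=> P_sym A_hurwitz k_gt0 decr; have [K K_gt0 A_le] := sqnorm_mulmx A.
have K1_gt0 : 0 < 1 + K by rewrite addr_gt0.
pose d := k / (2 * (1 + K)); have d_gt0 : 0 < d by rewrite divr_gt0 ?mulr_gt0.
have dK : d * (1 + K) = k / 2 by rewrite /d; field; rewrite gt_eqF.
have shiftE x y : bform (P - d%:M) x y = bform P x y - d * bform 1%:M x y.
  by rewrite bform_addmx bform_oppmx -scalemx1 bform_scalemx.
exists d => // v; have [->|v_neq0] := eqVneq v 0.
  by rewrite sqnorm0 mulr0 /bform mulmx0 mxE.
suff /(_ v v_neq0) : posdef (P - d%:M) by rewrite shiftE subr_gt0 bform1 => /ltW.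
apply: (hurwitz_posdef_lyap _ A_hurwitz) => [|w w_neq0].
  by rewrite linearB /= P_sym tr_scalar_mx.
have w_gt0 : 0 < sqnorm w by rewrite sqnorm_gt0.
have cross_le : d * (2 * `|bform 1%:M w (A *m w)|) <= k / 2 * sqnorm w.
  rewrite -dK -mulrA ler_pM2l // (le_trans (bform1_le _ _)) //.
  by rewrite mulrDl mul1r lerD2l.
have cross_ge : - (d * (2 * `|bform 1%:M w (A *m w)|)) <= d * (2 * bform 1%:M w (A *m w)).
  by rewrite -mulrN ler_pM2l // -mulrN ler_pM2l // lerNnormlW.
rewrite shiftE; move: (decr w) (mulr_gt0 k_gt0 w_gt0) cross_le cross_ge; lra.
Qed.
End RealLyapunov.

(** * Storage functions *)

Section Storage.
Context {F : idomainType}.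
Implicit Types (a c d p q : {poly F}) (y : nat -> F) (u : {poly {poly F}}).

(* The value of [p(D) w], where [y k] is that of the [k]-th derivative of [w]. *)
Definition jet_eval y p : F := \sum_(i < size p) p`_i * y i.

Lemma jet_eval_wide y p n : (size p <= n)%N ->
  jet_eval y p = \sum_(i < n) p`_i * y i.
Proof.
move=> sp; rewrite /jet_eval (big_ord_widen n (fun i => p`_i * y i) sp) big_mkcond.
apply: eq_bigr => i _; case: ifP => // /negbT; rewrite -leqNgt => pi.
by rewrite nth_default ?mul0r.
Qed.

Lemma jet_evalD y p q : jet_eval y (p + q) = jet_eval y p + jet_eval y q.
Proof.
rewrite (jet_eval_wide y (size_polyD p q)) (jet_eval_wide y (leq_maxl _ (size q))).
rewrite (jet_eval_wide y (leq_maxr (size p) _)) -big_split.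
by apply: eq_bigr => i _; rewrite coefD mulrDl.
Qed.

Lemma jet_evalZ y (k : F) p : jet_eval y (k *: p) = k * jet_eval y p.
Proof.
rewrite (jet_eval_wide y (size_scale_leq k p)) mulr_sumr.
by apply: eq_bigr => i _; rewrite coefZ mulrA.
Qed.

Lemma jet_evalXn y n : jet_eval y 'X^n = y n.
Proof.
rewrite /jet_eval size_polyXn big_ord_recr /= coefXn eqxx mul1r big1 ?add0r // => i _.
by rewrite coefXn ltn_eqF // mul0r.
Qed.

(* The quadratic form in the jet [y] with two-variable symbol [u]. *)
Definition jet_form n y u : F := \sum_(i < n) \sum_(j < n) u`_i`_j * (y i * y j).

(* The symbol of the supply [2 (a(D) w) (c(D) w)] minus the dissipation [\sum_d (d(D) w)^2]. *)
Definition dissipation_gap a c (ds : seq {poly F}) : {poly {poly F}} :=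
  a^:P * c%:P + c^:P * a%:P - \sum_(d <- ds) d^:P * d%:P.

Lemma coef_dissipation_gap a c ds i j : (dissipation_gap a c ds)`_i`_j =
  a`_i * c`_j + c`_i * a`_j - \sum_(d <- ds) d`_i * d`_j.
Proof.
have coef_prod p q : (p^:P * q%:P)`_i`_j = p`_i * q`_j.
  by rewrite coefMC coef_map coefCM.
rewrite !(coefB, coefD) !coef_prod !coef_sum; congr (_ - _).
by apply: eq_bigr => d _; exact: coef_prod.
Qed.

Lemma dissipation_gap_root a c ds :
  antipodal_mul a c + antipodal_mul c a = \sum_(d <- ds) antipodal_mul d d ->
  root (dissipation_gap a c ds) (- 'X).
Proof.
rewrite /antipodal_mul => balance; rewrite /root !hornerE horner_sum.
under eq_bigr => d _ do rewrite hornerM hornerC -[_.[_]]/(d \Po - 'X) mulrC.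
by rewrite -balance -/(a \Po - 'X) -/(c \Po - 'X); apply/eqP; ring.
Qed.

Lemma swap_dissipation_gap a c ds :
  swapXY (dissipation_gap a c ds) = dissipation_gap a c ds.
Proof.
have swapM p q : swapXY (p^:P * q%:P) = q^:P * p%:P.
  by rewrite rmorphM /= swapXY_polyC swapXY_map_polyC mulrC.
rewrite raddfB raddfD raddf_sum /= !swapM; congr (_ - _); first by rewrite addrC.
by apply: eq_bigr => d _; exact: swapM.
Qed.

(* The supply and the dissipation agree on [s + t = 0], so [s + t] divides the gap. *)
Lemma dissipation_gap_quotient a c ds r :
  antipodal_mul a c + antipodal_mul c a = \sum_(d <- ds) antipodal_mul d d ->
  (size (dissipation_gap a c ds) <= r.+1)%N ->
  exists q : {poly {poly F}}, [/\ dissipation_gap a c ds = q * ('X + 'Y),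
    forall i j, q`_i`_j = q`_j`_i & (size q <= r)%N].
Proof.
move=> /dissipation_gap_root/factor_theorem[q]; rewrite polyCN opprK => gapE size_gap.
have XY_monic : ('X + 'Y : {poly {poly F}}) \is monic.
  by rewrite -['Y]opprK -polyCN monicXsubC.
have q_sym : swapXY q = q.
  apply: (mulIf (monic_neq0 XY_monic)); rewrite -gapE -swap_dissipation_gap gapE.
  by rewrite rmorphM rmorphD /= swapXY_X swapXY_Y addrC.
exists q; split=> // [i j|]; first by rewrite -coef_swapXY q_sym.
have [->|q_neq0] := eqVneq q 0; first by rewrite size_poly0.
move: size_gap; rewrite gapE size_Mmonic //.
by rewrite -['Y]opprK -polyCN size_XsubC addn2.
Qed.

Lemma jet_form_mulXY (q : {poly {poly F}}) r y : (size q <= r)%N ->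
  (forall i j, q`_i`_j = q`_j`_i) ->
  jet_form r.+1 y (q * ('X + 'Y)) =
  2 * \sum_(i < r) \sum_(j < r) q`_i`_j * (y i * y j.+1).
Proof.
move=> sq q_sym.
have q_out i : q`_i`_r = 0 by rewrite q_sym [q`_r]nth_default ?coef0.
have coefXY i j : (q * ('X + 'Y))`_i`_j = (q * 'X)`_i`_j + (q * 'X)`_j`_i.
  rewrite mulrDr !coefD coefMC !coefMX; congr (_ + _).
  by case: j => [|j]; rewrite ?coef0 //= q_sym.
have shiftE : jet_form r.+1 y (q * 'X) =
    \sum_(i < r) \sum_(j < r) q`_i`_j * (y i * y j.+1).
  rewrite /jet_form big_ord_recl [X in X + _]big1 ?add0r => [|j _]; last first.
    by rewrite coefMX coef0 mul0r.
  rewrite [RHS]exchange_big; apply: eq_bigr => i _.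
  rewrite big_ord_recr /= coefMX /= q_out mul0r addr0.
  by apply: eq_bigr => j _; rewrite q_sym [y _ * _]mulrC.
rewrite /jet_form; under eq_bigr => i _.
  under eq_bigr => j _ do rewrite coefXY mulrDl.
  rewrite big_split; over.
rewrite big_split /= mulr_natl mulr2n -shiftE; congr (_ + _).
rewrite exchange_big /=.
by apply: eq_bigr => i _; apply: eq_bigr => j _; rewrite [y _ * _]mulrC.
Qed.

Lemma jet_form_dissipation_gap a c ds r y : (size a <= r)%N -> (size c <= r)%N ->
  (forall d, d \in ds -> (size d <= r)%N) ->
  jet_form r y (dissipation_gap a c ds) =
  2 * (jet_eval y a * jet_eval y c) - \sum_(d <- ds) jet_eval y d ^+ 2.
Proof.
move=> sa sc sd.
have jetM p q : (size p <= r)%N -> (size q <= r)%N ->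
    \sum_(i < r) \sum_(j < r) p`_i * q`_j * (y i * y j) = jet_eval y p * jet_eval y q.
  move=> sp sq; rewrite (jet_eval_wide y sp) (jet_eval_wide y sq) mulr_suml.
  by apply: eq_bigr => i _; rewrite mulr_sumr; apply: eq_bigr => j _; ring.
have -> : \sum_(d <- ds) jet_eval y d ^+ 2 =
    \sum_(i < r) \sum_(j < r) (\sum_(d <- ds) d`_i * d`_j) * (y i * y j).
  rewrite (eq_big_seq (fun d : {poly F} =>
      \sum_(i < r) \sum_(j < r) d`_i * d`_j * (y i * y j))) => [|d /sd sdr]; last first.
    by rewrite jetM // expr2.
  rewrite exchange_big; apply: eq_bigr => i _; rewrite exchange_big.
  by apply: eq_bigr => j _; rewrite mulr_suml.
rewrite mulr_natl mulr2n {2}[_ * jet_eval y c]mulrC -!jetM // -big_split -sumrB.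
apply: eq_bigr => i _; rewrite -big_split -sumrB; apply: eq_bigr => j _ /=.
by rewrite coef_dissipation_gap mulrBl mulrDl.
Qed.

Lemma size_dissipation_gap a c ds r : (size a <= r)%N -> (size c <= r)%N ->
  (forall d, d \in ds -> (size d <= r)%N) ->
  (size (dissipation_gap a c ds) <= r)%N.
Proof.
move=> sa sc sd; apply/leq_sizeP => i ri; apply/polyP => j.
rewrite coef_dissipation_gap coef0 !(nth_default _ (leq_trans _ ri)) // !mul0r add0r.
rewrite big_seq big1 ?subr0 // => d /sd sdr.
by rewrite nth_default ?mul0r // (leq_trans sdr).
Qed.

Theorem storage_matrix a c ds r :
  (size a <= r.+1)%N -> (size c <= r.+1)%N ->
  (forall d, d \in ds -> (size d <= r.+1)%N) ->
  antipodal_mul a c + antipodal_mul c a = \sum_(d <- ds) antipodal_mul d d ->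
  exists2 Q : 'M[F]_r, Q^T = Q & forall y,
    2 * bform Q (\col_k y k) (\col_k y k.+1) =
    2 * (jet_eval y a * jet_eval y c) - \sum_(d <- ds) jet_eval y d ^+ 2.
Proof.
move=> sa sc sd balance; have size_gap := size_dissipation_gap sa sc sd.
have [q [gapE q_sym sq]] := dissipation_gap_quotient balance size_gap.
exists (\matrix_(i, j) q`_i`_j) => [|y]; first by apply/matrixP => i j; rewrite !mxE.
rewrite -(jet_form_dissipation_gap y sa sc sd) gapE (jet_form_mulXY y sq q_sym).
rewrite /bform -mulmxA mxE; congr (_ * _); apply: eq_bigr => i _.
rewrite !mxE mulr_sumr; apply: eq_bigr => j _; rewrite !mxE.
by rewrite mulrCA.
Qed.
End Storage.

(** * Rank-one perturbations of a controllable matrix *)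

Lemma horner_char_poly (F : comNzRingType) n (A : 'M[F]_n) x :
  (char_poly A).[x] = \det (x%:M - A).
Proof.
rewrite /char_poly -horner_evalE -det_map_mx; congr (\det _).
apply/matrixP => i j; rewrite !mxE /= horner_evalE.
by rewrite hornerD hornerN hornerC hornerMn hornerX.
Qed.

Lemma det_opp_scalar_sub (F : comNzRingType) n (A : 'M[F]_n) x :
  \det ((- x)%:M - A) = (-1) ^+ n * \det (x%:M + A).
Proof. by rewrite raddfN -opprD -scaleN1r detZ. Qed.

Lemma sylvester_det (F : comNzRingType) m n (B : 'M[F]_(m, n)) (D : 'M[F]_(n, m)) :
  \det (1%:M + B *m D) = \det (1%:M + D *m B).
Proof.
have lowerE : block_mx 1%:M (- D) B 1%:M =
    block_mx 1%:M 0 B 1%:M *m block_mx 1%:M (- D) 0 (1%:M + B *m D).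
  by rewrite mulmx_block !mul0mx !mulmx0 !mul1mx !mulmx1 !addr0 mulmxN addrCA addNr addr0.
have upperE : block_mx 1%:M (- D) B 1%:M =
    block_mx (1%:M + D *m B) (- D) 0 1%:M *m block_mx 1%:M 0 B 1%:M.
  by rewrite mulmx_block !mul0mx !mulmx0 !mul1mx !mulmx1 !add0r mulNmx addrK.
have := congr1 determinant lowerE; rewrite upperE !det_mulmx !det_lblock !det_ublock.
by rewrite !det1 !mul1r !mulr1 => ->.
Qed.

Lemma det_rank_one_update (F : comUnitRingType) n (M : 'M[F]_n) (u : 'cV_n) (v : 'rV_n) :
  M \in unitmx -> \det (M + u *m v) = \det M * (1 + (v *m invmx M *m u) 0 0).
Proof.
move=> M_unit; have -> : M + u *m v = M *m (1%:M + invmx M *m u *m v).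
  by rewrite mulmxDr mulmx1 mulmxA mulKVmx.
by rewrite det_mulmx sylvester_det mulmxA det_mx11 mxE [1%:M _ _]mxE.
Qed.

Lemma eq_poly_off_roots (F : numFieldType) (d p q : {poly F}) : d != 0 ->
  (forall x, d.[x] != 0 -> p.[x] = q.[x]) -> p = q.
Proof.
move=> d_neq0 pq; apply/eqP; rewrite -subr_eq0 -(mulrI_eq0 _ (mulfI d_neq0)).
set f := d * _; apply/eqP/(@roots_geq_poly_eq0 _ f [seq i%:R | i <- iota 0 (size f)]).
- apply/allP => x _; rewrite rootM; have [//|dx_neq0] := boolP (root d x).
  by apply/rootP; rewrite hornerD hornerN pq // subrr.
- by rewrite map_inj_uniq ?iota_uniq // => i j /eqP; rewrite eqr_nat => /eqP.
by rewrite size_map size_iota.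
Qed.

Section Flat.
Context {F : fieldType} {n : nat}.
Local Notation r := n.+1.
Variables (A : 'M[F]_r) (g : 'cV[F]_r).
Local Notation a := (char_poly A).

Definition krylov_mx : 'M[F]_r := \matrix_(i, j) (A ^+ j *m g) i 0.

(* The coefficient of [s^(m - 1)] in [adj (s - A) g]. *)
Definition adj_coef m : 'cV[F]_r := \sum_(j < r.+1 - m) a`_(m + j) *: (A ^+ j *m g).

Lemma adj_coef_step m : (m <= r)%N ->
  adj_coef m = a`_m *: g + A *m adj_coef m.+1.
Proof.
move=> mr; rewrite /adj_coef subSn // big_ord_recl addn0 mul1mx; congr (_ + _).
rewrite subSS mulmx_sumr; apply: eq_bigr => j _.
by rewrite lift0 addnS addSn -scalemxAr exprS mulmxA.
Qed.

Lemma adj_coef0 : adj_coef 0 = 0.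
Proof.
rewrite -(mul0mx _ g) -(Cayley_Hamilton A) /adj_coef subn0 /horner_mx /horner_morph.
rewrite horner_coef size_map_poly size_char_poly mulmx_suml.
apply: eq_bigr => j _; rewrite coef_map /= -mulmxE.
by rewrite add0n mul_scalar_mx -scalemxAl.
Qed.

Lemma adj_coef_top : adj_coef r = g.
Proof.
rewrite /adj_coef subSnn big_ord1 addn0 mul1mx.
by have /monicP := char_poly_monic A; rewrite lead_coefE size_char_poly => ->; rewrite scale1r.
Qed.

Lemma adj_coef_over : adj_coef r.+1 = 0.
Proof. by rewrite /adj_coef subnn big_ord0. Qed.

(* The states [adj (D - A) g w] of [z' = A z + g u] are parametrized by the flat output [w],
   for which [u = a(D) w]. *)
Definition flat_mx : 'M[F]_r := \matrix_(i, k) adj_coef k.+1 i 0.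

Definition flat_state (y : nat -> F) : 'cV[F]_r := flat_mx *m \col_k y k.

Lemma flat_stateE y : flat_state y = \sum_(k < r) y k *: adj_coef k.+1.
Proof.
apply/matrixP => i j; rewrite ord1 summxE mxE; apply: eq_bigr => k _.
by rewrite !mxE mulrC.
Qed.

Lemma flat_state_shift y :
  A *m flat_state y + jet_eval y a *: g = flat_state (fun k => y k.+1).
Proof.
have -> : flat_state (fun k => y k.+1) = \sum_(k < r.+1) y k *: adj_coef k.
  by rewrite flat_stateE [RHS]big_ord_recl adj_coef0 scaler0 add0r.
under [RHS]eq_bigr => k _ do rewrite (adj_coef_step (leq_ord k)) scalerDr scalerA.
rewrite big_split /= -scaler_suml addrC (@jet_eval_wide _ _ _ r.+1) ?size_char_poly //.
congr (_ + _); last by congr (_ *: _); apply: eq_bigr => k _; rewrite mulrC.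
rewrite big_ord_recr /= adj_coef_over mulmx0 scaler0 addr0 flat_stateE mulmx_sumr.
by apply: eq_bigr => k _; rewrite scalemxAr.
Qed.

Lemma krylov_sub_flat : (krylov_mx^T <= flat_mx^T)%MS.
Proof.
have row_flat (k : 'I_r) : row k flat_mx^T = (adj_coef k.+1)^T.
  by apply/rowP => i; rewrite !mxE.
have adj_sub k : (k <= r)%N -> ((adj_coef k)^T <= flat_mx^T)%MS.
  case: k => [|k] kr; first by rewrite adj_coef0 trmx0 sub0mx.
  by rewrite -(row_flat (Ordinal kr)) row_sub.
have g_sub : (g^T <= flat_mx^T)%MS by rewrite -adj_coef_top adj_sub.
have A_stable : (flat_mx^T *m A^T <= flat_mx^T)%MS.
  apply/row_subP => k; rewrite row_mul row_flat -trmx_mul.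
  have -> : A *m adj_coef k.+1 = adj_coef k - a`_k *: g.
    by rewrite (adj_coef_step (ltnW (ltn_ord k))) addrC addKr.
  rewrite linearB linearZ /= -scaleNr addmx_sub //; last exact: scalemx_sub.
  exact/adj_sub/ltnW/ltn_ord.
apply/row_subP => j.
have -> : row j krylov_mx^T = (A ^+ j *m g)^T by apply/rowP => i; rewrite !mxE.
elim: (nat_of_ord j) => [|k IHk]; first by rewrite mul1mx.
by rewrite exprS -mulmxA trmx_mul (submx_trans (submxMr _ IHk)).
Qed.

Lemma flat_mx_unit : \rank krylov_mx = r -> flat_mx \in unitmx.
Proof.
move=> rank_krylov; rewrite -unitmx_tr -row_full_unit -col_leq_rank.
by rewrite -{1}rank_krylov -mxrank_tr mxrankS // krylov_sub_flat.
Qed.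

Lemma flat_parametrization z u : \rank krylov_mx = r ->
  exists y, flat_state y = z /\ jet_eval y a = u.
Proof.
move=> /flat_mx_unit flat_unit; pose v := invmx flat_mx *m z.
pose y k : F := if (k < r)%N then v (inord k) 0 else u - \sum_(i < r) a`_i * v i 0.
have yE (i : 'I_r) : y i = v i 0 by rewrite /y ltn_ord inord_val.
exists y; split.
  rewrite /flat_state (_ : \col_k y k = v) ?mulKVmx //.
  by apply/colP => i; rewrite mxE yE.
have aE : a`_r = 1 by have /monicP := char_poly_monic A; rewrite lead_coefE size_char_poly.
rewrite (@jet_eval_wide _ _ _ r.+1) ?size_char_poly // big_ord_recr /= aE mul1r.
by under eq_bigr => i _ do rewrite yE; rewrite /y ltnn addrC subrK.
Qed.

End Flat.

Section RankOneUpdate.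
Context {F : numFieldType} {n : nat}.
Local Notation r := n.+1.
Variables (A : 'M[F]_r) (g h : 'cV[F]_r).
Local Notation B := (A - g *m h^T).

Definition feedback_poly : {poly F} := \poly_(k < r) (h^T *m adj_coef A g k.+1) 0 0.

Lemma jet_eval_feedback y : jet_eval y feedback_poly = (h^T *m flat_state A g y) 0 0.
Proof.
rewrite (jet_eval_wide y (size_poly _ _)) flat_stateE mulmx_sumr summxE.
by apply: eq_bigr => k _; rewrite coef_poly ltn_ord -scalemxAr [RHS]mxE mulrC.
Qed.

Lemma jet_eval_geom (p : {poly F}) x : jet_eval (fun k => x ^+ k) p = p.[x].
Proof. by rewrite horner_coef. Qed.

Lemma resolvent_flat_state x :
  (x%:M - A) *m flat_state A g (fun k => x ^+ k) = (char_poly A).[x] *: g.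
Proof.
rewrite mulmxBl mul_scalar_mx -jet_eval_geom; apply/eqP.
rewrite subr_eq addrC flat_state_shift !flat_stateE scaler_sumr; apply/eqP.
by apply: eq_bigr => k _; rewrite scalerA exprS.
Qed.

Lemma char_poly_feedback : char_poly B = char_poly A + feedback_poly.
Proof.
apply: (@eq_poly_off_roots _ (char_poly A)) => [|x ax_neq0].
  exact: monic_neq0 (char_poly_monic A).
have xA_unit : x%:M - A \in unitmx by rewrite unitmxE unitfE -horner_char_poly.
have flatE : flat_state A g (fun k => x ^+ k) =
    (char_poly A).[x] *: (invmx (x%:M - A) *m g).
  by rewrite scalemxAr -resolvent_flat_state mulKmx.
have feedbackE : feedback_poly.[x] =
    (char_poly A).[x] * (h^T *m invmx (x%:M - A) *m g) 0 0.
  by rewrite -jet_eval_geom jet_eval_feedback flatE -scalemxAr mxE mulmxA.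
rewrite hornerD feedbackE !horner_char_poly -[X in _ = X + _]mulr1 -mulrDr.
by rewrite -det_rank_one_update // opprB addrA addrAC.
Qed.

Lemma det_antipodal_pair x : x%:M - A \in unitmx -> x%:M + A \in unitmx ->
  \det (x%:M - A) * \det (x%:M + B) + \det (x%:M + A) * \det (x%:M - B) =
  2 * \det ((x ^+ 2)%:M - A *m B).
Proof.
set M := _ - A; set N := _ + A => M_unit N_unit.
have MN_unit : M *m N \in unitmx by rewrite unitmx_mul M_unit.
have MN_comm : M *m N = N *m M.
  by rewrite !(mulmxBl, mulmxBr, mulmxDl, mulmxDr) !mul_scalar_mx !mul_mx_scalar addrAC.
have resolventE : 2 *: (invmx (M *m N) *m (A *m g)) = invmx M *m g - invmx N *m g.
  apply: (can_inj (mulKmx MN_unit)); rewrite -scalemxAr mulKVmx // mulmxBr.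
  rewrite {1}MN_comm -!mulmxA !mulKVmx // -mulmxBl scalemxAl; congr (_ *m _).
  by rewrite /M /N opprB addrC addrA subrK -mulr2n scaler_nat.
have -> : x%:M + B = N + (- g) *m h^T by rewrite mulNmx addrA.
have -> : x%:M - B = M + g *m h^T by rewrite opprB addrA addrAC.
have MN_eq : M *m N = (x ^+ 2)%:M - A *m A.
  rewrite mulmxBl !mulmxDr -scalar_mxM mul_scalar_mx mul_mx_scalar opprD addrA addrK.
  by rewrite expr2.
have -> : (x ^+ 2)%:M - A *m B = M *m N + (A *m g) *m h^T.
  by rewrite MN_eq mulmxBr mulmxA opprB addrA addrAC.
rewrite !det_rank_one_update // det_mulmx mulmxN.
have := congr1 (fun w => (h^T *m w) 0 0) resolventE.
rewrite -scalemxAr mulmxBr !mulmxA !mxE => /(congr1 (fun e => \det M * \det N * e)).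
by move=> e_eq; ring: e_eq.
Qed.

Lemma char_poly_antipodal :
  antipodal_mul (char_poly A) (char_poly B) + antipodal_mul (char_poly B) (char_poly A) =
  2 *: (char_poly (- (A *m B)) \Po - 'X^2).
Proof.
have reflE (p : {poly F}) x : (p \Po - 'X).[x] = p.[- x].
  by rewrite horner_comp hornerN hornerX.
apply: (@eq_poly_off_roots _ (antipodal_mul (char_poly A) (char_poly A))) => [|x].
  by rewrite mulf_neq0 ?comp_poly2_eq0 ?size_polyN ?size_polyX ?monic_neq0 ?char_poly_monic.
rewrite /antipodal_mul hornerM reflE !horner_char_poly det_opp_scalar_sub.
rewrite mulf_eq0 mulf_eq0 signr_eq0 /=.
rewrite negb_or -!unitfE -!unitmxE => /andP[M_unit N_unit].
rewrite /antipodal_mul [LHS]hornerD [RHS]hornerZ !hornerM !reflE.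
rewrite [(_ \Po - 'X^2).[_]]horner_comp hornerN hornerXn.
rewrite !horner_char_poly !det_opp_scalar_sub.
rewrite [RHS]mulrCA -det_antipodal_pair //; ring.
Qed.
End RankOneUpdate.

Lemma char_polyN (F : comNzRingType) n (M : 'M[F]_n) :
  char_poly (- M) = (-1) ^+ n *: (char_poly M \Po - 'X).
Proof.
have -> : char_poly M \Po - 'X = \det (map_mx (comp_poly (- 'X)) (char_poly_mx M)).
  by rewrite det_map_mx.
rewrite -mul_polyC polyC_exp polyCN -detZ; congr (\det _).
apply/matrixP => i j; rewrite !mxE /= comp_polyB comp_polyC raddfMn /= comp_polyX polyCN.
by rewrite polyC1 mulN1r opprB mulNrn !opprK addrC.
Qed.

Lemma mup_comp_oppX (F : fieldType) (p : {poly F}) : mup 0 (p \Po - 'X) = mup 0 p.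
Proof.
have [->|p_neq0] := eqVneq p 0; first by rewrite comp_poly0.
have [m [q]] := multiplicity_XsubC p 0; rewrite p_neq0 /= => q0 ->.
have powE : ('X - 0%:P) ^+ m \Po - 'X = (-1) ^+ m * ('X - 0%:P) ^+ m :> {poly F}.
  by rewrite rmorphXn /= comp_polyB comp_polyX comp_polyC polyC0 !subr0 [LHS]exprNn.
rewrite comp_polyM powE mulrA (mupMr _ q0) mupMr // /root hornerM horner_comp.
rewrite !(hornerN, hornerX) oppr0 mulf_neq0 // horner_exp hornerN hornerC.
by rewrite signr_eq0.
Qed.

(** * A common Lyapunov function for a rank-one pair *)

(* Along [T w' = w] with [z = w'], the derivative of [w^T P w] is at most [- k |w|^2]. *)
Definition dissipates {F : realFieldType} m (P : 'M[F]_m) k (T : 'M_m) :=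
  forall z, 2 * bform P z (T *m z) <= - k * sqnorm (T *m z).

Definition common_lyapunov {F : realFieldType} m (T1 T2 : 'M[F]_m) :=
  exists P k d, [/\ P^T = P, 0 < k, 0 < d, forall z, d * sqnorm z <= bform P z z &
    dissipates P k T1 /\ dissipates P k T2].

Section RankOnePair.
Context {F : rcfType} {n : nat}.
Local Notation r := n.+1.
Variables (A : 'M[F]_r) (g h : 'cV[F]_r).
Local Notation B := (A - g *m h^T).

Hypothesis controllable_Ag : \rank (krylov_mx A g) = r.
Hypothesis mulAB_no_neg_eig : forall l : F, l < 0 -> ~~ eigenvalue (A *m B) l.
Hypothesis mulAB_simple_zero : mup 0 (char_poly (A *m B)) = 1%N.

Lemma antipodal_dissipation : exists (eps : F) (d : {poly F}), [/\ 0 < eps, (size d <= r.+1)%N &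
  antipodal_mul (char_poly A) (char_poly B) + antipodal_mul (char_poly B) (char_poly A) =
  \sum_(p <- d :: scaled_powers eps r) antipodal_mul p p].
Proof.
rewrite char_poly_antipodal; apply: simple_zero_dissipation.
- exact: size_char_poly.
- by rewrite (monicP (char_poly_monic _)).
- move=> x x_gt0; have := mulAB_no_neg_eig (_ : - x < 0); rewrite oppr_lt0 => /(_ x_gt0).
  rewrite eigenvalue_root_char char_polyN rootZ ?signr_eq0 //.
  by rewrite /root horner_comp hornerN hornerX.
by rewrite char_polyN -mul_polyC mupMr ?mup_comp_oppX // /root hornerC signr_eq0.
Qed.

Lemma rank_one_dissipation : exists (P : 'M[F]_r) (k : F), [/\ P^T = P, 0 < k &
  forall (z : 'cV_r) u, let dz := A *m z + u *: g in
    2 * bform P z dz <= 2 * (u * (u + (h^T *m z) 0 0)) - k * sqnorm dz].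
Proof.
have [eps [d [eps_gt0 sd balance]]] := antipodal_dissipation.
have [||p|Q Q_sym QE] := storage_matrix (r := r) _ _ _ balance.
- by rewrite size_char_poly.
- by rewrite size_char_poly.
- rewrite inE => /predU1P[-> //|/mapP[k]]; rewrite mem_index_iota => kr ->.
  by rewrite (leq_trans (size_scale_leq _ _)) // size_polyXn.
pose N := flat_mx A g; have N_unit : N \in unitmx by exact: flat_mx_unit.
have Ni_unit : invmx N \in unitmx by rewrite unitmx_inv.
have [K K_gt0 Ni_le] := sqnorm_unitmx Ni_unit.
exists ((invmx N)^T *m Q *m invmx N), (eps ^+ 2 / K); split.
- by rewrite !trmx_mul trmxK Q_sym mulmxA.
- by rewrite divr_gt0 ?exprn_gt0.
move=> z u /=; have [y [zE uE]] := flat_parametrization z u controllable_Ag.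
have dzE : A *m z + u *: g = N *m \col_k y k.+1 by rewrite -zE -uE flat_state_shift.
have jet_feedback : jet_eval y (char_poly B) = u + (h^T *m z) 0 0.
  by rewrite char_poly_feedback jet_evalD uE jet_eval_feedback zE.
have dissE : eps ^+ 2 * sqnorm (\col_(k < r) y k.+1) =
    \sum_(p <- scaled_powers eps r) jet_eval y p ^+ 2.
  rewrite big_map big_mkord mulr_sumr; apply: eq_bigr => k _.
  by rewrite jet_evalZ jet_evalXn mxE exprMn.
rewrite bform_mulmxr bform_mulmxl dzE mulKmx // -{1}zE /flat_state mulKmx //.
rewrite QE uE jet_feedback big_cons lerD2l lerN2 -dissE ler_wpDl ?sqr_ge0 //.
have := Ni_le (N *m \col_k y k.+1); rewrite mulKmx // => N_le.
by rewrite -mulrA ler_pM2l ?exprn_gt0 // ler_pdivrMl.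
Qed.

Theorem rank_one_common_lyapunov : A \in unitmx -> hurwitz A -> common_lyapunov A B.
Proof.
move=> A_unit A_hurwitz; have [P [k [P_sym k_gt0 diss]]] := rank_one_dissipation.
have dissA : dissipates P k A.
  by move=> z; have := diss z 0; rewrite /= scale0r addr0 mul0r mulr0 sub0r mulNr.
have dissB : dissipates P k B.
  move=> z; have := diss z (- (h^T *m z) 0 0); rewrite /= addNr !mulr0 sub0r -mulNr.
  suff -> : A *m z + - (h^T *m z) 0 0 *: g = B *m z by [].
  rewrite mulmxBl -mulmxA [h^T *m z]mx11_scalar mul_mx_scalar scaleNr.
  by rewrite [_%:M 0 0]mxE eqxx.
have [K K_gt0 A_le] := sqnorm_unitmx A_unit.
have [|z|d d_gt0 coercive] := @hurwitz_lyap_coercive _ _ A P (k / K) P_sym A_hurwitz.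
- by rewrite divr_gt0.
- apply: le_trans (dissA z) _; rewrite !mulNr lerN2 -mulrA ler_pM2l //.
  by rewrite ler_pdivrMl.
by exists P, k, d.
Qed.
End RankOnePair.

(** * Descriptor pencils *)

Lemma map_poly_complex_horner (p : {poly R}) (z : R[i]) :
  let w := Chorner p (complex.Re z, complex.Im z) in
  (map_poly (real_complex R) p).[z] = Complex w.1 w.2.
Proof.
rewrite map_polyE horner_Poly /Chorner; case: z => a b /=.
elim: (polyseq p) => [|k s IHs] //=; rewrite IHs.
set w := foldr _ _ _; rewrite /Cmul /=.
by apply/eqP; rewrite eq_complex /= addr0 !eqxx.
Qed.

Lemma pencil_poly_complex_horner n (E A : 'M[R]_n) (z : R[i]) :
  (map_poly (real_complex R) (pencil_poly E A)).[z] =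
  \det (z *: map_mx (real_complex R) E - map_mx (real_complex R) A).
Proof.
rewrite /pencil_poly -det_map_mx /= -horner_evalE -det_map_mx; congr (\det _).
apply/matrixP => i j; rewrite !mxE /= rmorphB /= rmorphM /= map_polyX !map_polyC /=.
by rewrite horner_evalE !hornerE.
Qed.

Lemma desc_stable_complex n (E A : 'M[R]_n) (z : R[i]) : desc_stable E A ->
  \det (z *: map_mx (real_complex R) E - map_mx (real_complex R) A) = 0 ->
  complex.Re z < 0.
Proof.
move=> stable; rewrite -pencil_poly_complex_horner map_poly_complex_horner.
move=> /eqP; rewrite eq_complex /= => /andP[/eqP re0 /eqP im0].
by apply/RltP/(stable _ (complex.Im z)); rewrite [LHS]surjective_pairing re0 im0.
Qed.

Lemma Re_inv_lt0 (F : rcfType) (z : F[i]) : complex.Re z^-1 < 0 -> complex.Re z < 0.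
Proof.
rewrite !ltNge; apply: contra; case: z => a b /= a_ge0.
by rewrite divr_ge0 // addr_ge0 // sqr_ge0.
Qed.

Section FullRankDecomposition.
Variables (n r : nat) (E A : 'M[R]_n) (X Y : 'M[R]_(n, r)).
Hypothesis A_unit : A \in unitmx.
Hypothesis E_decomp : full_rank_decomp E X Y.
Local Notation T := (Etilde A X Y).
Local Notation toC := (map_mx (real_complex R)).

Lemma full_rank_decompE : E = X *m Y^T. Proof. by case: E_decomp => _ []. Qed.

(* If [v T = l v], then [w = v Y^T A^-1] satisfies [w E = l w A]. *)
Lemma desc_stable_hurwitz : desc_stable E A -> T \in unitmx -> hurwitz T.
Proof.
move=> stable T_unit l /eigenvalueP[v vT v_neq0].
have l_neq0 : l != 0.
  apply: contraNneq v_neq0 => l0; have TC_unit : toC T \in unitmx by rewrite map_unitmx.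
  by rewrite -[v](mulmxK TC_unit) vT l0 scale0r mul0mx.
pose w := v *m toC Y^T *m toC (invmx A).
have wX : w *m toC X = l *: v by rewrite -vT /w /Etilde !map_mxM /= !mulmxA.
have wE : w *m toC E = l *: (w *m toC A).
  rewrite full_rank_decompE map_mxM /= mulmxA wX /w -mulmxA -map_mxM /= mulVmx //.
  by rewrite map_mx1 mulmx1 -scalemxAl.
have w_neq0 : w != 0.
  apply: contraNneq v_neq0 => w0; move: wX; rewrite w0 mul0mx => /esym/eqP.
  by rewrite scaler_eq0 (negbTE l_neq0).
apply/Re_inv_lt0/(desc_stable_complex stable)/eqP/det0P; exists w => //.
by rewrite mulmxBr -scalemxAr wE scalerA mulVf // scale1r subrr.
Qed.

Lemma mxrank_compression (M : 'M_r) : \rank (invmx A *m X *m M *m Y^T) = \rank M.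
Proof.
have [rank_X [rank_Y _]] := E_decomp.
rewrite mxrankMfree; last by rewrite /row_free mxrank_tr rank_Y.
rewrite eqmxMfull // /row_full.
by rewrite eqmxMfull ?rank_X // row_full_unit unitmx_inv.
Qed.

Lemma mxpow_compression k :
  mxpow (invmx A *m E) k.+1 = invmx A *m X *m mxpow T k *m Y^T.
Proof.
elim: k => [|k IHk]; first by rewrite /mxpow /= !mulmx1 full_rank_decompE mulmxA.
rewrite {1}/mxpow iterS -/(mxpow _ k.+1) IHk [mxpow T k.+1]/mxpow iterS -/(mxpow T k).
by rewrite full_rank_decompE /Etilde !mulmxA.
Qed.

Lemma desc_index_rank k : desc_index E A k.+1 ->
  \rank (mxpow T k.+1) = \rank (mxpow T k).
Proof.
move=> [/eqmxP images _].
by rewrite -[LHS]mxrank_compression -[RHS]mxrank_compression -!mxpow_compression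
  -mxrank_tr images mxrank_tr.
Qed.

Lemma desc_index1_unit : desc_index E A 1 -> T \in unitmx.
Proof.
move=> /desc_index_rank; rewrite /mxpow /= mulmx1 mxrank1 => rank_T.
by rewrite -row_free_unit /row_free rank_T.
Qed.

Lemma desc_index2_rank : desc_index E A 2 -> \rank (T *m T) = \rank T.
Proof. by move=> /desc_index_rank; rewrite /mxpow /= !mulmx1. Qed.

End FullRankDecomposition.

(* On the image of [T], where [T] is invertible when [\rank (T *m T) = \rank T],
   this matrix is the inverse of [T]. *)
Definition image_inv (F : fieldType) r (T : 'M[F]_r) : 'M_r := T *m pinvmx (T *m T).

Lemma image_invK (F : fieldType) r (T : 'M[F]_r) : \rank (T *m T) = \rank T ->
  image_inv T *m (T *m T) = T.
Proof.
move=> rank_sq; rewrite /image_inv mulmxKpV //.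
by rewrite -(geq_leqif (mxrank_leqif_sup (submxMl T T))) rank_sq.
Qed.

(** * Real analysis *)

Section RealAnalysis.
Local Open Scope R_scope.
Implicit Types (f g V : R -> R) (D : R -> Prop) (a b s t d l : R).

Definition left_of t : R -> Prop := fun s => s < t.
Definition right_of t : R -> Prop := fun s => t < s.

Lemma right_of_adherent t : adhDa (right_of t) t.
Proof.
move=> d d_gt0; exists (t + d / 2); rewrite /right_of /Rdist.
by split; [Lra.lra | apply: Rabs_def1; Lra.lra].
Qed.

Lemma limit1_in_near_ext f g D l t d : 0 < d ->
  (forall s, D s -> Rabs (s - t) < d -> f s = g s) ->
  limit1_in f D l t -> limit1_in g D l t.
Proof.
move=> d_gt0 fg f_lim e e_gt0; have [a [a_gt0 fa]] := f_lim e e_gt0.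
exists (Rmin a d); split; first exact: Rmin_pos.
by move=> s [Ds /Rmin_Rgt_l[sa sd]]; rewrite -fg //; apply: fa.
Qed.

Lemma limit1_in_near_ge f D l t a d : adhDa D t -> 0 < d ->
  (forall s, D s -> Rabs (s - t) < d -> a <= f s) ->
  limit1_in f D l t -> a <= l.
Proof.
move=> D_adh d_gt0 af f_lim; apply: Rnot_lt_le => la.
have [|b [b_gt0 fb]] := f_lim (a - l); first by Lra.lra.
have [s [Ds /Rmin_Rgt_l[sb sd]]] := D_adh (Rmin b d) (Rmin_pos _ _ b_gt0 d_gt0).
have := fb s (conj Ds sb); have := af s Ds sd.
by rewrite /= /Rdist => a_le /Rabs_def2; Lra.lra.
Qed.

Lemma continuity_pt_limit1_in f D t : continuity_pt f t -> limit1_in f D (f t) t.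
Proof.
move=> f_cont e e_gt0; have [d [d_gt0 fd]] := f_cont e e_gt0.
exists d; split=> // s [Ds sd]; case: (Req_EM_T t s) => [<-|ts].
  by rewrite /= /Rdist Rminus_diag Rabs_R0.
by apply: fd.
Qed.

Lemma continuity_pt_sides f t : limit1_in f (left_of t) (f t) t ->
  limit1_in f (right_of t) (f t) t -> continuity_pt f t.
Proof.
move=> f_left f_right e e_gt0.
have [a [a_gt0 fa]] := f_left e e_gt0; have [b [b_gt0 fb]] := f_right e e_gt0.
exists (Rmin a b); split; first exact: Rmin_pos.
move=> s [[_ ts] /Rmin_Rgt_l[sa sb]]; case: (Rtotal_order s t) => [st|[st|st]].
- by apply: fa.
- by case: ts.
by apply: fb.
Qed.

Lemma nonincreasing_of_nonpos_deriv f a b : a <= b ->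
  (forall t, a <= t <= b -> continuity_pt f t) ->
  (forall t, a < t < b -> exists2 d, derivable_pt_lim f t d & d <= 0) ->
  f b <= f a.
Proof.
move=> ab f_cont f_deriv; case: (Req_EM_T a b) => [->|ab_neq]; first exact: Rle_refl.
have {ab_neq}ab : a < b by Lra.lra.
have f_derivable t : a < t < b -> derivable_pt f t.
  move=> t_ab; apply: constructive_indefinite_description.
  by have [d fd _] := f_deriv t t_ab; exists d.
have [|t [t_ab]] := MVT f id a b f_derivable (fun t _ => derivable_pt_id t) ab f_cont.
  by move=> t _; exact/derivable_continuous_pt/derivable_pt_id.
have [d fd d_le0] := f_deriv t t_ab.
rewrite derive_pt_id (derive_pt_eq_0 _ _ _ _ fd) /id => mvt_eq.
suff : f b - f a <= 0 by Lra.lra.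
by rewrite -[f b - f a]Rmult_1_r -mvt_eq; Lra.nra.
Qed.

Lemma nonincreasing_finite_exceptions f (l : list R) a b : a <= b ->
  (forall t, a <= t <= b -> continuity_pt f t) ->
  (forall t, a < t < b -> ~ List.In t l -> exists2 d, derivable_pt_lim f t d & d <= 0) ->
  f b <= f a.
Proof.
elim: l a b => [|p l IHl] a b ab f_cont f_deriv.
  by apply: nonincreasing_of_nonpos_deriv => // t t_ab; apply: f_deriv => // -[].
have on_subinterval u v : a <= u -> u <= v -> v <= b -> ~ (u < p < v) -> f v <= f u.
  move=> au uv vb p_out; apply: IHl => // t t_uv; first by apply: f_cont; Lra.lra.
  move=> t_l; apply: f_deriv => [|[pt|//]]; first by Lra.lra.
  by apply: p_out; rewrite pt.
have [p_in|p_out] : (a < p < b) \/ ~ (a < p < b) by Lra.lra.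
  by apply: (Rle_trans _ (f p)); apply: on_subinterval; Lra.lra.
by apply: on_subinterval => //; exact: Rle_refl.
Qed.

Lemma derivable_pt_lim_exp_scal a t :
  derivable_pt_lim (fun s => exp (a * s)) t (exp (a * t) * a).
Proof.
apply: (derivable_pt_lim_comp (fun s => a * s) exp); last exact: derivable_pt_lim_exp.
rewrite -{2}[a]Rmult_1_r; apply: derivable_pt_lim_scal; exact: derivable_pt_lim_id.
Qed.

Lemma exp_decay_finite_exceptions V a t0 t (l : list R) : t0 <= t ->
  limit1_in V (right_of t0) (V t0) t0 ->
  (forall s, t0 < s <= t -> continuity_pt V s) ->
  (forall s, t0 < s < t -> ~ List.In s l ->
     exists2 d, derivable_pt_lim V s d & d <= - a * V s) ->
  V t <= exp (- (a * (t - t0))) * V t0.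
Proof.
move=> t0t V_lim V_cont V_deriv.
case: (Req_EM_T t0 t) => [<-|t0t_neq].
  by rewrite Rminus_diag Rmult_0_r Ropp_0 exp_0 Rmult_1_l; exact: Rle_refl.
have exp_cont s : continuity_pt (fun u => exp (a * u)) s.
  by apply: derivable_continuous_pt; exists (exp (a * s) * a); exact: derivable_pt_lim_exp_scal.
pose W s := exp (a * s) * V s.
have W_noninc s : t0 < s <= t -> W t <= W s.
  move=> s_t0t; apply: (@nonincreasing_finite_exceptions W l); first by Lra.lra.
    by move=> u u_st; apply: continuity_pt_mult; [exact: exp_cont | apply: V_cont; Lra.lra].
  move=> u u_st u_l; have [|d Vd d_le] := V_deriv u _ u_l; first by Lra.lra.
  exists (exp (a * u) * a * V u + exp (a * u) * d).
    exact: derivable_pt_lim_mult (derivable_pt_lim_exp_scal _ _) Vd.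
  by have := exp_pos (a * u); Lra.nra.
have W_lim : limit1_in W (right_of t0) (W t0) t0.
  by apply: limit_mul V_lim; apply: (continuity_pt_limit1_in (f := fun s => exp (a * s))).
have W_le : W t <= W t0.
  apply: (@limit1_in_near_ge _ _ _ t0 _ (t - t0)) W_lim; first exact: right_of_adherent.
    by Lra.lra.
  by move=> s t0s /Rabs_def2 ?; apply: W_noninc; rewrite /right_of in t0s; Lra.lra.
have -> : V t = exp (- (a * t)) * W t.
  by rewrite /W -Rmult_assoc -exp_plus Rplus_opp_l exp_0 Rmult_1_l.
have -> : - (a * (t - t0)) = - (a * t) + a * t0 by Lra.lra.
rewrite exp_plus Rmult_assoc; apply: Rmult_le_compat_l => //.
exact/Rlt_le/exp_pos.
Qed.

End RealAnalysis.

(** * Switching signals *)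

Section SwitchingSignals.
Local Open Scope R_scope.
Implicit Types (sigma : R -> nat) (s t d : R).

Lemma list_gap_right (l : list R) t :
  exists2 d, 0 < d & forall s, t < s < t + d -> ~ List.In s l.
Proof.
elim: l => [|p l [d d_gt0 gap]]; first by exists 1; [Lra.lra | move=> s _ []].
case: (Rle_lt_dec p t) => [pt|tp].
  by exists d => // s s_td [ps|]; [Lra.lra | exact: gap].
exists (Rmin d (p - t)); first by apply: Rmin_pos; Lra.lra.
move=> s [ts s_lt]; have /Rmin_Rgt_l[sd sp] : s - t < Rmin d (p - t) by Lra.lra.
by case=> [ps|]; [Lra.lra | apply: gap; Lra.lra].
Qed.

Lemma locally_const_interval sigma a b :
  (forall t, a < t < b -> locally_const sigma t) ->
  forall s t, a < s < b -> a < t < b -> sigma s = sigma t.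
Proof.
move=> sigma_lc; suff ordered s t : a < s -> s <= t -> t < b -> sigma s = sigma t.
  move=> s t s_ab t_ab; case: (Rle_lt_dec s t) => st; first by apply: ordered; Lra.lra.
  by symmetry; apply: ordered; Lra.lra.
move=> a_s st tb; pose f u := INR (sigma u).
have f_deriv u : s <= u <= t -> derivable_pt_lim f u 0.
  move=> u_st; have [|d [d_gt0 near_u]] := sigma_lc u; first by Lra.lra.
  apply: (@derivable_pt_lim_locally_ext (fun=> f u) f u (u - d) (u + d)); first by Lra.lra.
    by move=> w w_near; rewrite /f near_u //; apply: Rabs_def1; Lra.lra.
  exact: derivable_pt_lim_const.
have f_deriv_oo u : s < u < t -> derivable_pt_lim f u 0.
  by move=> u_st; apply: f_deriv; Lra.lra.
apply: INR_eq; symmetry.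
apply: (null_derivative_loc f s t (fun u u_st => exist _ 0 (f_deriv_oo u u_st))) => //.
  by move=> u u_st; apply: derivable_continuous_pt; exists 0; apply: f_deriv.
by split=> //; exact: Rle_refl.
Qed.

Lemma right_mode_exists sigma t :
  piecewise_constant sigma -> exists j, right_mode sigma t j.
Proof.
move=> sigma_pc; have [l l_exc] := sigma_pc t (t + 1).
have [d d_gt0 gap] := list_gap_right l t.
have m_gt0 : 0 < Rmin d 1 by apply: Rmin_pos; Lra.lra.
exists (sigma (t + Rmin d 1 / 2)), (Rmin d 1); split=> // s ts s_lt.
apply: (@locally_const_interval _ t (t + Rmin d 1)); [|Lra.lra|Lra.lra].
move=> u [tu u_lt]; have /Rmin_Rgt_l[ud u1] : u - t < Rmin d 1 by Lra.lra.
by apply: l_exc; [Lra.lra | Lra.lra | apply: gap; Lra.lra].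
Qed.

Lemma right_mode_unique sigma t i j :
  right_mode sigma t i -> right_mode sigma t j -> i = j.
Proof.
move=> [d [d_gt0 right_i]] [e [e_gt0 right_j]].
have m_gt0 : 0 < Rmin d e by exact: Rmin_pos.
have [ed_lt de_lt] : Rmin d e / 2 < d /\ Rmin d e / 2 < e.
  by apply: Rmin_Rgt_l; rewrite /Rgt; Lra.lra.
by rewrite -(right_i (t + Rmin d e / 2)) ?(right_j (t + Rmin d e / 2)) //; Lra.lra.
Qed.

Lemma locally_const_open sigma i a b : (forall s, a < s < b -> sigma s = i) ->
  forall s, a < s < b -> locally_const sigma s.
Proof.
move=> sigma_i s s_ab; exists (Rmin (s - a) (b - s)).
split; first by apply: Rmin_pos; Lra.lra.
by move=> u /Rmin_Rgt_l[/Rabs_def2 ua /Rabs_def2 ub]; rewrite !sigma_i //; Lra.lra.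
Qed.

Lemma locally_const_right_mode sigma t :
  locally_const sigma t -> right_mode sigma t (sigma t).
Proof.
move=> [d [d_gt0 near_t]]; exists d; split=> // s ts s_lt.
by apply: near_t; apply: Rabs_def1; Lra.lra.
Qed.

Definition active_mode sigma t : nat := epsilon (inhabits 0%N) (right_mode sigma t).

Section ActiveMode.
Variable sigma : R -> nat.
Hypothesis sigma_pc : piecewise_constant sigma.

Lemma active_mode_right_mode t : right_mode sigma t (active_mode sigma t).
Proof. by apply: epsilon_spec; exact: right_mode_exists. Qed.

Lemma active_modeE t i : right_mode sigma t i -> active_mode sigma t = i.
Proof. exact/right_mode_unique/active_mode_right_mode. Qed.

Lemma active_mode_locally_const t : locally_const sigma t -> active_mode sigma t = sigma t.
Proof. by move=> /locally_const_right_mode/active_modeE. Qed.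

Lemma active_mode_left t i : left_mode sigma t i ->
  exists2 d, 0 < d & forall s, t - d < s < t -> active_mode sigma s = i.
Proof.
move=> [d [d_gt0 left_i]]; exists d => // s [ds st]; apply: active_modeE.
by exists (t - s); split=> [|u su ut]; [|apply: left_i]; Lra.lra.
Qed.

Lemma active_mode_right t : exists2 d, 0 < d & forall s, t < s < t + d ->
  locally_const sigma s /\ active_mode sigma s = active_mode sigma t.
Proof.
have [d [d_gt0 right_t]] := active_mode_right_mode t; exists d => // s s_td.
have s_lc : locally_const sigma s.
  by apply: (locally_const_open (i := active_mode sigma t)) s_td => u [? ?]; exact: right_t.
by split=> //; rewrite active_mode_locally_const // right_t //; Lra.lra.
Qed.

Lemma active_mode_near t : locally_const sigma t ->
  exists2 d, 0 < d & forall s, t - d < s < t + d ->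
    locally_const sigma s /\ active_mode sigma s = active_mode sigma t.
Proof.
move=> t_lc; have [d [d_gt0 near_t]] := t_lc; exists d => // s s_near.
have sigma_t u : t - d < u < t + d -> sigma u = sigma t.
  by move=> u_near; apply: near_t; apply: Rabs_def1; Lra.lra.
have s_lc := locally_const_open sigma_t s_near.
by split=> //; rewrite !active_mode_locally_const // sigma_t.
Qed.
End ActiveMode.
End SwitchingSignals.

(** * Vector-valued limits and derivatives *)

Lemma derivable_pt_lim_sum (I : Type) (l : seq I) (f : I -> R -> R) (d : I -> R) t :
  (forall i, derivable_pt_lim (f i) t (d i)) ->
  derivable_pt_lim (fun s => \sum_(i <- l) f i s) t (\sum_(i <- l) d i).
Proof.
move=> f_deriv; elim: l => [|i l IHl].
  rewrite big_nil (_ : (fun s => _) = fun=> 0); first exact: derivable_pt_lim_const.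
  by apply: functional_extensionality => s; rewrite big_nil.
rewrite big_cons (_ : (fun s => _) = plus_fct (f i) (fun s => \sum_(i <- l) f i s)).
  exact: derivable_pt_lim_plus.
by apply: functional_extensionality => s; rewrite big_cons.
Qed.

Lemma limit1_in_sum (I : Type) (l : seq I) (f : I -> R -> R) (v : I -> R) D t :
  (forall i, limit1_in (f i) D (v i) t) ->
  limit1_in (fun s => \sum_(i <- l) f i s) D (\sum_(i <- l) v i) t.
Proof.
move=> f_lim; elim: l => [|i l IHl].
  rewrite big_nil (_ : (fun s => _) = fun=> 0); first exact: (limit_free (fun=> 0)).
  by apply: functional_extensionality => s; rewrite big_nil.
rewrite big_cons (_ : (fun s => _) = fun s => Rplus (f i s) (\sum_(i <- l) f i s)).
  exact: limit_plus.
by apply: functional_extensionality => s; rewrite big_cons.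
Qed.

Definition col_lim n (x : R -> 'cV[R]_n) (D : R -> Prop) (v : 'cV[R]_n) t :=
  forall i, limit1_in (fun s => x s i 0) D (v i 0) t.

Section VectorCalculus.
Implicit Types (t d : R) (D : R -> Prop).

Lemma has_deriv_mulmx m n (M : 'M[R]_(m, n)) x t dx :
  has_deriv x t dx -> has_deriv (fun s => M *m x s) t (M *m dx).
Proof.
move=> x_deriv i; rewrite mxE.
rewrite (_ : (fun s => _) = fun s => \sum_j M i j * x s j 0).
  by apply: derivable_pt_lim_sum => j; apply: derivable_pt_lim_scal.
by apply: functional_extensionality => s; rewrite mxE.
Qed.

Lemma has_deriv_bform n (P : 'M[R]_n) x y t dx dy :
  has_deriv x t dx -> has_deriv y t dy ->
  derivable_pt_lim (fun s => bform P (x s) (y s)) t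
    (bform P dx (y t) + bform P (x t) dy).
Proof.
move=> x_deriv y_deriv; have Py_deriv := has_deriv_mulmx P y_deriv.
rewrite !bformE -big_split /=.
rewrite (_ : (fun s => _) = fun s => \sum_i x s i 0 * (P *m y s) i 0).
  apply: derivable_pt_lim_sum => i.
  exact: (derivable_pt_lim_mult _ _ _ _ _ (x_deriv i) (Py_deriv i)).
by apply: functional_extensionality => s; rewrite bformE.
Qed.

Lemma has_deriv_near_ext n (x y : R -> 'cV[R]_n) t d dx : Rlt R0 d ->
  (forall s, Rlt (Rminus t d) s /\ Rlt s (Rplus t d) -> x s = y s) ->
  has_deriv x t dx -> has_deriv y t dx.
Proof.
move=> d_gt0 xy x_deriv i.
apply: (@derivable_pt_lim_locally_ext _ _ t (Rminus t d) (Rplus t d)) (x_deriv i).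
  by Lra.lra.
by move=> s /xy ->.
Qed.

Lemma has_deriv_col_lim n (x : R -> 'cV[R]_n) t dx :
  has_deriv x t dx -> col_lim x (D_x no_cond t) (x t) t.
Proof.
move=> x_deriv i; apply: (derivable_continuous_pt (fun s => x s i 0)).
by exists (dx i 0); exact: x_deriv.
Qed.

Lemma col_lim_mulmx m n (M : 'M[R]_(m, n)) x D v t :
  col_lim x D v t -> col_lim (fun s => M *m x s) D (M *m v) t.
Proof.
move=> x_lim i; rewrite mxE.
rewrite (_ : (fun s => _) = fun s => \sum_j M i j * x s j 0).
  apply: limit1_in_sum => j; apply: (limit_mul _ _ _ _ _ _ _ (x_lim j)).
  exact: (limit_free (fun=> M i j)).
by apply: functional_extensionality => s; rewrite mxE.
Qed.

Lemma col_lim_bform n (P : 'M[R]_n) x y D v w t :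
  col_lim x D v t -> col_lim y D w t ->
  limit1_in (fun s => bform P (x s) (y s)) D (bform P v w) t.
Proof.
move=> x_lim y_lim; have Py_lim := col_lim_mulmx P y_lim; rewrite bformE.
rewrite (_ : (fun s => _) = fun s => \sum_i x s i 0 * (P *m y s) i 0).
  by apply: limit1_in_sum => i; exact: (limit_mul _ _ _ _ _ _ (x_lim i) (Py_lim i)).
by apply: functional_extensionality => s; rewrite bformE.
Qed.

Lemma col_lim_near_ext n (x y : R -> 'cV[R]_n) D v t d : Rlt R0 d ->
  (forall s, D s -> Rlt (Rabs (Rminus s t)) d -> x s = y s) ->
  col_lim x D v t -> col_lim y D v t.
Proof.
move=> d_gt0 xy x_lim i; apply: limit1_in_near_ext d_gt0 _ (x_lim i) => s Ds sd.
by rewrite xy.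
Qed.

Lemma col_lim_unique n (x : R -> 'cV[R]_n) D v w t : adhDa D t ->
  col_lim x D v t -> col_lim x D w t -> v = w.
Proof.
move=> D_adh xv xw; apply/colP => i; exact: single_limit D_adh (xv i) (xw i).
Qed.

Lemma col_lim_sides n (x : R -> 'cV[R]_n) t :
  col_lim x (left_of t) (x t) t -> col_lim x (right_of t) (x t) t ->
  col_lim x (D_x no_cond t) (x t) t.
Proof.
move=> x_left x_right i.
exact: (continuity_pt_sides (f := fun s => x s i 0) (x_left i) (x_right i)).
Qed.

Lemma sqr_vnorm n (v : 'cV[R]_n) : vnorm v ^+ 2 = sqnorm v.
Proof. by apply: sqrt_sqrt; apply/RleP; exact: sqnorm_ge0. Qed.

Lemma vnorm_ge0 n (v : 'cV[R]_n) : 0 <= vnorm v.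
Proof. by apply/RleP; exact: sqrt_pos. Qed.

Lemma norm_entry_le_vnorm n (v : 'cV[R]_n) i : `|v i 0| <= vnorm v.
Proof.
rewrite -(@ler_pXn2r _ 2) ?nnegrE ?vnorm_ge0 // real_normK ?num_real //.
rewrite sqr_vnorm /sqnorm (bigD1 i) //= lerDl.
by apply: sumr_ge0 => j _; rewrite sqr_ge0.
Qed.

Lemma vnorm_col_lim n (x : R -> 'cV[R]_n) D v t :
  (forall e, Rlt R0 e -> exists2 d, Rlt R0 d &
     forall s, D s -> Rlt (Rabs (Rminus s t)) d -> Rlt (vnorm (x s - v)) e) ->
  col_lim x D v t.
Proof.
move=> x_lim i e e_gt0; have [d d_gt0 near_t] := x_lim e e_gt0.
exists d; split=> // s [Ds sd]; have /RltP x_near := near_t s Ds sd.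
apply/RltP; apply: le_lt_trans x_near.
by have := norm_entry_le_vnorm (x s - v) i; rewrite !mxE.
Qed.

Lemma left_lim_col_lim n (x : R -> 'cV[R]_n) t v :
  left_lim x t v -> col_lim x (left_of t) v t.
Proof.
move=> x_lim; apply: vnorm_col_lim => e /x_lim[d [d_gt0 near_t]].
by exists d => // s st /Rabs_def2 sd; apply: near_t => //; Lra.lra.
Qed.

Lemma right_lim_col_lim n (x : R -> 'cV[R]_n) t v :
  right_lim x t v -> col_lim x (right_of t) v t.
Proof.
move=> x_lim; apply: vnorm_col_lim => e /x_lim[d [d_gt0 near_t]].
by exists d => // s ts /Rabs_def2 sd; apply: near_t => //; Lra.lra.
Qed.

End VectorCalculus.

(** * Trajectories of switched descriptor systems *)

Lemma column_image_annihilator (F : fieldType) n (T : 'M[F]_n) :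
  exists2 K : 'M_n, K *m T = 0 &
  forall w : 'cV_n, K *m w = 0 -> exists v : 'cV_n, w = T *m v.
Proof.
exists (cokermx T^T)^T; first by apply: trmx_inj; rewrite trmx_mul trmxK mulmx_coker trmx0.
move=> w Kw; have /submxP[v vE] : (w^T <= T^T)%MS.
  by rewrite submxE -[cokermx _]trmxK -trmx_mul Kw trmx0.
by exists v^T; rewrite -[w]trmxK vE trmx_mul trmxK.
Qed.

(* Recovers a consistent state [x] from [Y^T x]. *)
Definition consistency_mx n r (A : 'M[R]_n) (X Y : 'M[R]_(n, r)) : 'M[R]_(n, r) :=
  invmx A *m X *m image_inv (Etilde A X Y).

(* [Y^T x] stays in the image of [Etilde A X Y], hence so does its derivative. *)
Lemma descriptor_flow_reduction n r (E A : 'M[R]_n) (X Y : 'M[R]_(n, r)) x (t d : R) :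
  A \in unitmx -> E = X *m Y^T ->
  \rank (Etilde A X Y *m Etilde A X Y) = \rank (Etilde A X Y) -> Rlt R0 d ->
  (forall s, Rlt (Rminus t d) s /\ Rlt s (Rplus t d) ->
     exists2 dx, has_deriv x s dx & E *m dx = A *m x s) ->
  exists dz, [/\ has_deriv (fun s => Y^T *m x s) t dz,
    Etilde A X Y *m dz = Y^T *m x t & x t = consistency_mx A X Y *m (Y^T *m x t)].
Proof.
move=> A_unit E_eq rank_sq d_gt0 flow; rewrite /consistency_mx.
have := image_invK rank_sq; move: (image_inv _) => D; set T := Etilde A X Y => TD.
have xE s dx : E *m dx = A *m x s -> x s = invmx A *m X *m (Y^T *m dx).
  by move=> flow_s; rewrite -[LHS](mulKmx A_unit) -flow_s E_eq !mulmxA.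
have zE s dx : E *m dx = A *m x s -> Y^T *m x s = T *m (Y^T *m dx).
  by move=> /xE ->; rewrite /T /Etilde !mulmxA.
clearbody T; have [|dx x_deriv flow_t] := flow t; first by Lra.lra.
have z_deriv := has_deriv_mulmx Y^T x_deriv.
exists (Y^T *m dx); rewrite -(zE _ _ flow_t); split=> //.
have [K KT K_image] := column_image_annihilator T.
have [|v dzE] := K_image (Y^T *m dx).
  have Kz_deriv := has_deriv_mulmx K z_deriv.
  apply/matrixP => i j; rewrite ord1 [RHS]mxE; apply: uniqueness_limite (Kz_deriv i) _.
  apply: (@derivable_pt_lim_locally_ext (fun=> 0) _ t (Rminus t d) (Rplus t d)).
  - by Lra.lra.
  - by move=> s /flow[dxs _ flow_s]; rewrite (zE _ _ flow_s) mulmxA KT mul0mx mxE.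
  exact: derivable_pt_lim_const.
rewrite {1}(xE _ _ flow_t) (zE _ _ flow_t) dzE -!mulmxA; congr (_ *m (_ *m _)).
by rewrite -{1}TD !mulmxA.
Qed.

Section SwitchedTrajectory.
Variables (n r : nat) (E A : nat -> 'M[R]_n) (X Y : nat -> 'M[R]_(n, r)).
Local Notation T i := (Etilde (A i) (X i) (Y i)).
Local Notation G i := (consistency_mx (A i) (X i) (Y i)).
Hypothesis A_unit : forall i, A i \in unitmx.
Hypothesis E_eq : forall i, E i = X i *m (Y i)^T.
Hypothesis T_rank_sq : forall i, \rank (T i *m T i) = \rank (T i).

Variables (t0 : R) (sigma : R -> nat) (x : R -> 'cV[R]_n).
Hypothesis sigma_pc : piecewise_constant sigma.
Hypothesis x_initial : right_lim x t0 (x t0).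
Hypothesis x_flow : forall t, Rlt t0 t -> locally_const sigma t ->
  exists dx, has_deriv x t dx /\ E (sigma t) *m dx = A (sigma t) *m x t.
Hypothesis x_jump : forall t, Rlt t0 t -> ~ locally_const sigma t ->
  exists xm i j, left_lim x t xm /\ right_lim x t (x t) /\
    left_mode sigma t i /\ right_mode sigma t j /\ (Y j)^T *m x t = (Y i)^T *m xm.

Local Notation mode := (active_mode sigma).

Definition reduced_state t : 'cV[R]_r := (Y (mode t))^T *m x t.

Lemma mode_flow_near t : Rlt t0 t -> locally_const sigma t ->
  exists2 d, Rlt R0 d & forall s, Rlt (Rminus t d) s /\ Rlt s (Rplus t d) ->
    mode s = mode t /\
    exists2 dx, has_deriv x s dx & E (mode t) *m dx = A (mode t) *m x s.
Proof.
move=> t0t t_lc; have [d d_gt0 near_t] := active_mode_near sigma_pc t_lc.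
exists (Rmin d (Rminus t t0)); first by apply: Rmin_pos; Lra.lra.
move=> s [ds sd].
have [d_t0 t0_s] : Rlt (Rabs (Rminus s t)) d /\ Rlt (Rabs (Rminus s t)) (Rminus t t0).
  by apply: Rmin_Rgt_l; apply: Rabs_def1; Lra.lra.
have [|s_lc mode_s] := near_t s; first by move: d_t0 => /Rabs_def2; Lra.lra.
have [|dx [x_deriv flow_s]] := x_flow _ s_lc; first by move: t0_s => /Rabs_def2; Lra.lra.
by split=> //; exists dx; rewrite // -mode_s active_mode_locally_const.
Qed.

Lemma reduced_flow t : Rlt t0 t -> locally_const sigma t ->
  exists dz, [/\ has_deriv reduced_state t dz, T (mode t) *m dz = reduced_state t &
    x t = G (mode t) *m reduced_state t].
Proof.
move=> t0t t_lc; have [d d_gt0 near_t] := mode_flow_near t0t t_lc.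
have [|dz [z_deriv dzE xE]] := descriptor_flow_reduction (A_unit _) (E_eq _)
  (T_rank_sq (mode t)) d_gt0 (x := x) (t := t); first by move=> s /near_t[].
exists dz; split=> //; apply: has_deriv_near_ext d_gt0 _ z_deriv => s /near_t[mode_s _].
by rewrite /reduced_state mode_s.
Qed.

Lemma right_continuous_at_switch t : Rle t0 t -> t = t0 \/ ~ locally_const sigma t ->
  right_lim x t (x t).
Proof.
move=> t0t [->//|t_nlc]; case: (Req_EM_T t0 t) => [<- //|t0t_neq].
by have [|xm [i [j [_ []]]]] := x_jump _ t_nlc; first by Lra.lra.
Qed.

Lemma reduced_state_right_lim t : right_lim x t (x t) ->
  col_lim reduced_state (right_of t) (reduced_state t) t.
Proof.
move=> /right_lim_col_lim/(col_lim_mulmx (Y (mode t))^T).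
have [d d_gt0 right_t] := active_mode_right sigma_pc t.
apply: (col_lim_near_ext d_gt0) => s ts /Rabs_def2 sd; rewrite /right_of in ts.
by have [|_ mode_s] := right_t s; [Lra.lra | rewrite /reduced_state mode_s].
Qed.

Lemma reduced_state_continuous t : Rlt t0 t ->
  col_lim reduced_state (D_x no_cond t) (reduced_state t) t.
Proof.
move=> t0t; case: (classic (locally_const sigma t)) => [t_lc|t_nlc].
  by have [dz [/has_deriv_col_lim]] := reduced_flow t0t t_lc.
have [xm [i [j [x_left [x_right [left_i [right_j jump]]]]]]] := x_jump t0t t_nlc.
apply: col_lim_sides; last exact: reduced_state_right_lim.
have -> : reduced_state t = (Y i)^T *m xm.
  by rewrite /reduced_state (active_modeE sigma_pc right_j).
have [d d_gt0 mode_i] := active_mode_left sigma_pc left_i.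
apply: (col_lim_near_ext d_gt0) (col_lim_mulmx (Y i)^T (left_lim_col_lim x_left)).
move=> s st /Rabs_def2 sd; rewrite /left_of in st.
by rewrite /reduced_state mode_i //; Lra.lra.
Qed.

Lemma state_of_reduced t : Rle t0 t -> x t = G (mode t) *m reduced_state t.
Proof.
move=> t0t; case: (classic (Rlt t0 t /\ locally_const sigma t)) => [[t0_lt t_lc]|not_flow_t].
  by have [dz []] := reduced_flow t0_lt t_lc.
have x_right : right_lim x t (x t).
  apply: right_continuous_at_switch => //.
  case: (Req_EM_T t t0) => [|t_neq]; [by left | right=> t_lc].
  by apply: not_flow_t; split=> //; Lra.lra.
apply: (col_lim_unique (right_of_adherent t) (right_lim_col_lim x_right)).
have [d d_gt0 right_t] := active_mode_right sigma_pc t.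
apply: (col_lim_near_ext d_gt0) (col_lim_mulmx (G (mode t)) (reduced_state_right_lim x_right)).
move=> s ts /Rabs_def2 sd; rewrite /right_of in ts.
have [|s_lc <-] := right_t s; first by Lra.lra.
by have [|dz []] := reduced_flow _ s_lc; first by Lra.lra.
Qed.

Variables (P : 'M[R]_r) (a k d p : R).
Hypothesis P_sym : P^T = P.
Hypotheses (d_gt0 : 0 < d) (p_gt0 : 0 < p).
Hypothesis P_dissipates : forall i, dissipates P k (T i).
Hypothesis P_ge : forall v, d * sqnorm v <= bform P v v.
Hypothesis P_le : forall v, bform P v v <= p * sqnorm v.
Hypothesis P_rate : forall v : 'cV_r, a * bform P v v <= k * sqnorm v.

Local Notation V := (fun s => bform P (reduced_state s) (reduced_state s)).

Lemma lyapunov_rate t : Rlt t0 t -> locally_const sigma t ->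
  exists2 dV, derivable_pt_lim V t dV & dV <= - a * V t.
Proof.
move=> t0t t_lc; have [dz [z_deriv dzE _]] := reduced_flow t0t t_lc.
exists (bform P dz (reduced_state t) + bform P (reduced_state t) dz).
  exact: has_deriv_bform.
rewrite (bformC dz) // -mulr2n -mulr_natl bformC //.
have := P_dissipates (mode t) dz; rewrite dzE => /le_trans; apply.
by rewrite !mulNr lerN2.
Qed.

Lemma lyapunov_decay t : Rle t0 t ->
  V t <= exp (- (a * (t - t0))) * V t0.
Proof.
move=> t0t; have [l l_exc] := sigma_pc t0 t; apply/RleP.
apply: (exp_decay_finite_exceptions (V := V) (l := l)) => // [|s s_t0t|s s_t0t s_l].
- by apply: col_lim_bform; apply: reduced_state_right_lim.
- by apply: col_lim_bform; apply: reduced_state_continuous; Lra.lra.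
have s_lc : locally_const sigma s by apply: l_exc => //; Lra.lra.
have [|dV V_deriv /RleP dV_le] := lyapunov_rate _ s_lc; first by Lra.lra.
by exists dV.
Qed.

Variables (KG KY : R).
Hypothesis KG_gt0 : 0 < KG.
Hypothesis G_le : forall i v, sqnorm (G i *m v) <= KG * sqnorm v.
Hypothesis Y_le : forall i v, sqnorm ((Y i)^T *m v) <= KY * sqnorm v.

Lemma state_decay t : Rle t0 t ->
  sqnorm (x t) <= KG / d * p * KY * exp (- (a * (t - t0))) * sqnorm (x t0).
Proof.
move=> t0t; have := lyapunov_decay t0t.
have : 0 < exp (- (a * (t - t0))) by apply/RltP; exact: exp_pos.
move: (exp _) => q q_gt0 V_le.
have z0_le : V t0 <= p * (KY * sqnorm (x t0)).
  by rewrite (le_trans (P_le _)) // ler_pM2l // Y_le.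
have z_le : d * sqnorm (reduced_state t) <= q * (p * (KY * sqnorm (x t0))).
  by rewrite (le_trans (P_ge _)) // (le_trans V_le) // ler_pM2l.
rewrite state_of_reduced // (le_trans (G_le _ _)) // -!mulrA ler_pM2l //.
by rewrite ler_pdivlMl // (le_trans z_le) // !mulrA [q * p]mulrC [p * q * KY]mulrAC.
Qed.

End SwitchedTrajectory.

(** * Exponential stability *)

Section TwoModes.
Variables (n r : nat) (E1 E2 A1 A2 : 'M[R]_n) (X1 Y1 X2 Y2 : 'M[R]_(n, r)).
Local Notation T1 := (Etilde A1 X1 Y1).
Local Notation T2 := (Etilde A2 X2 Y2).

Lemma sqnorm_decay_GUES K a : 0 < K -> 0 < a ->
  (forall t0 sigma x, is_solution E1 A1 E2 A2 Y1 Y2 t0 sigma x -> forall t, Rle t0 t ->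
     sqnorm (x t) <= K * exp (- (a * (t - t0))) * sqnorm (x t0)) ->
  GUES E1 A1 E2 A2 Y1 Y2.
Proof.
move=> K_gt0 a_gt0 decay; pose alpha := a / 2; exists (Num.sqrt K), alpha.
split; first by apply/RltP; rewrite sqrtr_gt0.
split; first by apply/RltP; rewrite divr_gt0.
move=> t0 sigma x sol t t0t; apply/RleP.
have half_exp : exp (- (alpha * (t - t0))) ^+ 2 = exp (- (a * (t - t0))).
  rewrite expr2 -[_ * _]/(Rmult _ _) -exp_plus; congr exp.
  rewrite -[LHS]/(- (alpha * (t - t0)) + - (alpha * (t - t0))).
  by rewrite -[RHS]/(- (a * (t - t0))) /alpha; field.
have exp_ge0 : 0 <= exp (- (alpha * (t - t0))) by apply/RleP/Rlt_le/exp_pos.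
move: (exp (- (alpha * _))) half_exp exp_ge0 => q qE q_ge0.
rewrite -[X in _ <= X]/(Num.sqrt K * q * vnorm (x t0)).
rewrite -(@ler_pXn2r _ 2) ?nnegrE ?mulr_ge0 ?vnorm_ge0 ?sqrtr_ge0 //.
by rewrite !exprMn !sqr_vnorm qE sqr_sqrtr ?(ltW K_gt0) //; exact: decay sol _ t0t.
Qed.

Lemma sqnorm_mulmx_sel m q (M1 M2 : 'M[R]_(m, q)) : exists2 K, 0 < K &
  forall i (v : 'cV_q), sqnorm (sel i M1 M2 *m v) <= K * sqnorm v.
Proof.
have [K1 K1_gt0 M1_le] := sqnorm_mulmx M1; have [K2 K2_gt0 M2_le] := sqnorm_mulmx M2.
exists (K1 + K2) => [|i v]; first exact: addr_gt0.
rewrite mulrDl /sel; case: ifP => _.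
  by rewrite (le_trans (M1_le v)) // lerDl mulr_ge0 ?sqnorm_ge0 // ltW.
by rewrite (le_trans (M2_le v)) // lerDr mulr_ge0 ?sqnorm_ge0 // ltW.
Qed.

Theorem common_lyapunov_GUES : A1 \in unitmx -> A2 \in unitmx ->
  E1 = X1 *m Y1^T -> E2 = X2 *m Y2^T ->
  \rank (T1 *m T1) = \rank T1 -> \rank (T2 *m T2) = \rank T2 ->
  common_lyapunov T1 T2 -> GUES E1 A1 E2 A2 Y1 Y2.
Proof.
move=> A1_unit A2_unit E1_eq E2_eq T1_rank T2_rank.
move=> [P [k [d [P_sym k_gt0 d_gt0 P_ge [diss1 diss2]]]]].
have [p p_gt0 P_le] := bform_le P.
have [KG KG_gt0 G_le] :=
  sqnorm_mulmx_sel (consistency_mx A1 X1 Y1) (consistency_mx A2 X2 Y2).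
have [KY KY_gt0 Y_le] := sqnorm_mulmx_sel Y1^T Y2^T.
pose a := k / p; apply: (@sqnorm_decay_GUES (KG / d * p * KY) a).
- by rewrite !mulr_gt0 ?invr_gt0.
- exact: divr_gt0.
move=> t0 sigma x [_ [sigma_pc [x_initial [x_flow x_jump]]]] t t0t.
apply: (@state_decay n r (fun i => sel i E1 E2) (fun i => sel i A1 A2)
  (fun i => sel i X1 X2) (fun i => sel i Y1 Y2) _ _ _ t0 sigma x _ _ _ _ P a k) => //.
1-4: by move=> i; rewrite /sel; case: ifP.
- by move=> v; rewrite -mulrA ler_pM2l // ler_pdivrMl.
- by move=> i v; move: (G_le i v); rewrite /sel; case: ifP.
by move=> i v; move: (Y_le i v); rewrite /sel; case: ifP.
Qed.
End TwoModes.

Lemma ctrb_mx_krylov n (T : 'M[R]_n.+1) g : ctrb_mx T g = krylov_mx T g.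
Proof.
have mxpowE k : mxpow T k = T ^+ k.
  by elim: k => [//|k IHk]; rewrite exprS -IHk.
by apply/matrixP => i j; rewrite !mxE mxpowE.
Qed.

Lemma controllable_common_lyapunov r (T : 'M[R]_r) (g h : 'cV_r) :
  T \in unitmx -> hurwitz T -> controllable T g ->
  (forall l, Rlt l R0 -> ~~ eigenvalue (T *m (T - g *m h^T)) l) ->
  mup 0 (char_poly (T *m (T - g *m h^T))) = 1%N ->
  common_lyapunov T (T - g *m h^T).
Proof.
case: r T g h => [|n] T g h T_unit T_hurwitz ctrb no_neg_eig simple_zero.
  by move: simple_zero; rewrite [char_poly _]det_mx00 mupNroot ?root1.
apply: rank_one_common_lyapunov => //; first by rewrite -ctrb_mx_krylov.
by move=> l /RltP; exact: no_neg_eig.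
Qed.

Theorem theorem5 (n r : nat) (E1 E2 A1 A2 : 'M[R]_n) (X1 Y1 X2 Y2 : 'M[R]_(n, r))
    (g h : 'cV[R]_r) :
  A1 \in unitmx -> A2 \in unitmx ->
  full_rank_decomp E1 X1 Y1 -> full_rank_decomp E2 X2 Y2 ->
  (* (a) *) desc_stable E1 A1 -> desc_stable E2 A2 ->
  (* (b) *) desc_index E1 A1 1 -> desc_index E2 A2 2 ->
  (* (c) *) Etilde A2 X2 Y2 = Etilde A1 X1 Y1 - g *m h^T ->
            controllable (Etilde A1 X1 Y1) g -> observable h^T (Etilde A1 X1 Y1) ->
  (* (d) *) (forall l : R, Rlt l R0 ->
               ~~ eigenvalue (Etilde A1 X1 Y1 *m Etilde A2 X2 Y2) l) ->
            mup 0 (char_poly (Etilde A1 X1 Y1 *m Etilde A2 X2 Y2)) = 1%N ->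
  GUES E1 A1 E2 A2 Y1 Y2.
Proof.
move=> A1_unit A2_unit decomp1 decomp2 stable1 _ index1 index2.
move=> T2_eq ctrb _ no_neg_eig simple_zero.
have T1_unit := desc_index1_unit A1_unit decomp1 index1.
have T1_hurwitz := desc_stable_hurwitz A1_unit decomp1 stable1 T1_unit.
apply: common_lyapunov_GUES => //.
- exact: full_rank_decompE decomp1.
- exact: full_rank_decompE decomp2.
- by apply: mxrankMfree; rewrite row_free_unit.
- exact: desc_index2_rank A2_unit decomp2 index2.
by rewrite T2_eq in no_neg_eig simple_zero *; apply: controllable_common_lyapunov.
Qed.
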